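(* MB Dom Game is fixed-parameter tractable (FPT) when parameterized by the modular-width of the input graph.
   Context: All graphs are finite, simple and undirected. The Maker-Breaker domination game on a graph $G$ is played by Dominator and Staller, who alternately claim one unclaimed vertex of $G$. Dominator wins if the vertices she claims contain a dominating set of $G$; otherwise Staller wins. MB Dom Game is the problem: given a graph $G$ and the first player (Dominator or Staller), decide which player has a winning strategy in the Maker-Breaker domination game on $G$ with the given player moving first. FPT with parameter $p$ means solvable in time $f(p)\cdot |V(G)|^{O(1)}$ for some computable function $f$. Let $G_0$ be a graph with vertices $v_1,\dots,v_n$ and let $G_1,\dots,G_n$ be graphs. The substitution operation $G_0(G_1,\dots,G_n)$ replaces each vertex $v_i$ of $G_0$ by the graph $G_i$ and adds all edges between $G_i$ and $G_j$ whenever $v_iv_j\in E(G_0)$. A modular decomposition of $G$ is an expression constructing $G$ using the operations: addition of an isolated vertex, disjoint union of two graphs, complete join of two graphs (disjoint copies plus all edges between them), and substitution. The width of a modular decomposition is the number of vertices of the largest graph $G_0$ used in a substitution operation in it. The modular-width $mw(G)$ is the minimum integer $m$ such that $G$ can be obtained by a modular decomposition of width $m$. *)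

(* Defs.v *)
From mathcomp Require Import all_boot.
From mathcomp Require Import boolp.

Set Implicit Arguments.
Unset Strict Implicit.
Unset Printing Implicit Defensive.

(** * Graphs *)

Record graph (V : finType) := Graph {
  adj : rel V;
  adj_sym : symmetric adj;
  adj_irr : irreflexive adj }.

Definition isomorphic (V W : finType) (G : graph V) (H : graph W) : Prop :=
  exists2 phi : V -> W, bijective phi &
    forall u v, adj G u v = adj H (phi u) (phi v).

Definition dominating (V : finType) (G : graph V) (D : {set V}) : bool :=
  [forall v, (v \in D) || [exists u in D, adj G u v]].

(** * The Maker-Breaker domination game *)

Inductive player := Dominator | Staller.

Definition opponent (p : player) : player :=
  match p with Dominator => Staller | Staller => Dominator end.

Section Game.
Variables (V : finType) (G : graph V) (first : player).

Definition turn (i : nat) : player := if odd i then opponent first else first.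

(* A play lists the claimed vertices in the order in which they are claimed.
   Plays run until every vertex is claimed; since claims are never undone, this
   does not change the winner. *)
Definition complete_play (s : seq V) : Prop := uniq s /\ size s = #|V|.

Definition claimed_by_dominator (s : seq V) : {set V} :=
  [set v in s | if turn (index v s) is Dominator then true else false].

Definition dominator_wins (s : seq V) : Prop :=
  exists2 D : {set V}, D \subset claimed_by_dominator s & dominating G D.

Definition wins (p : player) (s : seq V) : Prop :=
  match p with
  | Dominator => dominator_wins s
  | Staller => ~ dominator_wins s
  end.

(* A strategy maps the history of the play to the next claim. It is partial
   only because there may be no vertex left to claim. *)
Definition strategy := seq V -> option V.

Definition legal (sigma : strategy) : Prop :=
  forall h, uniq h -> size h < #|V| ->
    exists2 v, sigma h = Some v & v \notin h.

Definition consistent (p : player) (sigma : strategy) (s : seq V) : Prop :=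
  forall h v t, s = h ++ v :: t -> turn (size h) = p -> sigma h = Some v.

Definition has_winning_strategy (p : player) : Prop :=
  exists2 sigma : strategy, legal sigma &
    forall s, complete_play s -> consistent p sigma s -> wins p s.

End Game.

(** * Modular decompositions and modular-width *)

Section Operations.

Lemma single_sym : symmetric (fun _ _ : unit => false). Proof. by []. Qed.
Lemma single_irr : irreflexive (fun _ _ : unit => false). Proof. by []. Qed.
Definition single_graph : graph unit := Graph single_sym single_irr.

Section Binary.
Variables (V W : finType) (G : graph V) (H : graph W).

(* [b] is the adjacency between the two sides. *)
Definition sum_adj (b : bool) (x y : V + W) : bool :=
  match x, y with
  | inl u, inl v => adj G u v
  | inr u, inr v => adj H u v
  | _, _ => b
  end.

Lemma sum_adj_sym b : symmetric (sum_adj b).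
Proof. by move=> [u|u] [v|v] //=; apply: adj_sym. Qed.
Lemma sum_adj_irr b : irreflexive (sum_adj b).
Proof. by move=> [u|u] /=; apply: adj_irr. Qed.

Definition union_graph : graph (V + W)%type :=
  Graph (sum_adj_sym false) (sum_adj_irr false).
Definition join_graph : graph (V + W)%type :=
  Graph (sum_adj_sym true) (sum_adj_irr true).
End Binary.

Section Substitution.
Variables (n : nat) (G0 : graph 'I_n).
Variables (V : 'I_n -> finType) (G : forall i, graph (V i)).

(* When [tag x = tag y], [tagged_as x y] is [tagged y] in the type of
   [tagged x]. *)
Definition subst_adj (x y : {i : 'I_n & V i}) : bool :=
  if tag x == tag y then adj (G (tag x)) (tagged x) (tagged_as x y)
  else adj G0 (tag x) (tag y).

Lemma subst_adj_sym : symmetric subst_adj.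
Proof.
move=> [i u] [j v]; rewrite /subst_adj /=.
case: (eqVneq i j) => [eij|_]; last exact: adj_sym.
by case: _ / eij in v *; rewrite !tagged_asE /= adj_sym.
Qed.
Lemma subst_adj_irr : irreflexive subst_adj.
Proof. by move=> [i u]; rewrite /subst_adj eqxx tagged_asE adj_irr. Qed.

Definition subst_graph : graph {i : 'I_n & V i} :=
  Graph subst_adj_sym subst_adj_irr.
End Substitution.

End Operations.

(* Adding an isolated vertex to a graph that is already built is
   [MDUnion _ MDVertex]. *)
Inductive mdecomp : Type :=
| MDVertex
| MDUnion of mdecomp & mdecomp
| MDJoin of mdecomp & mdecomp
| MDSubst (n : nat) (G0 : graph 'I_n) (sub : 'I_n -> mdecomp).

Fixpoint md_vertices (e : mdecomp) : finType :=
  match e with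
  | MDVertex => unit
  | MDUnion e1 e2 | MDJoin e1 e2 => (md_vertices e1 + md_vertices e2)%type
  | MDSubst n _ sub => {i : 'I_n & md_vertices (sub i)}
  end.

Fixpoint md_graph (e : mdecomp) : graph (md_vertices e) :=
  match e with
  | MDVertex => single_graph
  | MDUnion e1 e2 => union_graph (md_graph e1) (md_graph e2)
  | MDJoin e1 e2 => join_graph (md_graph e1) (md_graph e2)
  | MDSubst n G0 sub => subst_graph G0 (fun i => md_graph (sub i))
  end.

Fixpoint md_width (e : mdecomp) : nat :=
  match e with
  | MDVertex => 0
  | MDUnion e1 e2 | MDJoin e1 e2 => maxn (md_width e1) (md_width e2)
  | MDSubst n _ sub => maxn n (\max_(i < n) md_width (sub i))
  end.

Definition has_md_of_width (V : finType) (G : graph V) (m : nat) : Prop :=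
  exists2 e : mdecomp, md_width e = m & isomorphic G (md_graph e).

Lemma exists_md_width (V : finType) (G : graph V) :
  exists m, `[< has_md_of_width G m >].
Proof.
pose a0 (i j : 'I_#|V|) := adj G (enum_val i) (enum_val j).
have a0s : symmetric a0 by move=> i j; apply: adj_sym.
have a0i : irreflexive a0 by move=> i; apply: adj_irr.
pose e := MDSubst (Graph a0s a0i) (fun=> MDVertex).
exists (md_width e); apply/asboolP; exists e => //.
pose phi v : md_vertices e := existT (fun=> unit) (enum_rank v) tt.
exists phi.
  exists (fun x : md_vertices e => enum_val (tag x)) => [v|[i []]] /=.
    exact: enum_rankK.
  by rewrite /phi enum_valK.
move=> u v; rewrite /= /subst_adj /=.
case: eqP => [/enum_rank_inj <-|_]; first by rewrite adj_irr.
by rewrite /a0 !enum_rankK.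
Qed.

Definition modular_width (V : finType) (G : graph V) : nat :=
  ex_minn (exists_md_width G).

(** * Computation *)

(* The machine model is a first-order, call-by-value functional language over
   binary trees, with unit-cost constructors, one-level case analysis, let and
   recursive calls (a variant of the tree languages F and WHILE of N. D. Jones,
   "Computability and Complexity from a Programming Perspective"). Trees are
   shared, not copied, so it simulates and is simulated by Turing machines and
   log-cost RAMs with polynomial overhead. *)

Inductive tree := Leaf | Node of tree & tree.

(* Variables are de Bruijn indices. [ECase e e0 e1] runs [e0] if [e] is [Leaf],
   and [e1] with the two subtrees bound to variables 0 and 1 otherwise. *)
Inductive expr :=
| EVar of nat
| ELeaf
| ENode of expr & expr
| ECase of expr & expr & expr
| ELet of expr & expr
| ECall of nat & expr.

(* The bodies of unary, mutually recursive functions; the first one is the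
   entry point. *)
Definition program := seq expr.

(* [eval p env e v t]: [e] evaluates to [v] in exactly [t] steps. *)
Inductive eval (p : program) : seq tree -> expr -> tree -> nat -> Prop :=
| eval_var env i v :
    onth env i = Some v -> eval p env (EVar i) v 1
| eval_leaf env :
    eval p env ELeaf Leaf 1
| eval_node env e1 e2 v1 v2 t1 t2 :
    eval p env e1 v1 t1 -> eval p env e2 v2 t2 ->
    eval p env (ENode e1 e2) (Node v1 v2) (t1 + t2).+1
| eval_case_leaf env e e0 e1 v t t0 :
    eval p env e Leaf t -> eval p env e0 v t0 ->
    eval p env (ECase e e0 e1) v (t + t0).+1
| eval_case_node env e e0 e1 a b v t t1 :
    eval p env e (Node a b) t -> eval p (a :: b :: env) e1 v t1 ->
    eval p env (ECase e e0 e1) v (t + t1).+1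
| eval_let env e1 e2 v1 v2 t1 t2 :
    eval p env e1 v1 t1 -> eval p (v1 :: env) e2 v2 t2 ->
    eval p env (ELet e1 e2) v2 (t1 + t2).+1
| eval_call env f e body a v t1 t2 :
    onth p f = Some body ->
    eval p env e a t1 -> eval p [:: a] body v t2 ->
    eval p env (ECall f e) v (t1 + t2).+1.

Definition runs_in (p : program) (input output : tree) (t : nat) : Prop :=
  eval p [:: input] (ECall 0 (EVar 0)) output t.

Lemma eval_det p env e v t v' t' :
  eval p env e v t -> eval p env e v' t' -> v = v' /\ t = t'.
Proof.
move=> H; elim: H v' t' => {env e v t} => [*|*|*|*|*|*|*];
  match goal with H : eval _ _ _ ?v' ?t' |- _ = ?v' /\ _ => inversion H end;
  subst;
  repeat match goal with
  | IH : (forall v t, eval ?p ?env ?e v t -> _), H : eval ?p ?env ?e _ _ |- _ =>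
      case: (IH _ _ H) => ? ?; clear H; subst
  | H1 : onth ?s ?i = Some _, H2 : onth ?s ?i = Some _ |- _ =>
      rewrite H1 in H2; case: H2 => ?; subst
  | H : Node _ _ = Node _ _ |- _ => case: H => ? ?; subst
  end; by [].
Qed.

Definition enc_bool (b : bool) : tree := if b then Node Leaf Leaf else Leaf.
Definition enc_seq (T : Type) (enc : T -> tree) (s : seq T) : tree :=
  foldr (fun x r => Node (enc x) r) Leaf s.
(* Unary. *)
Definition enc_nat (k : nat) : tree := enc_seq id (nseq k Leaf).

Definition computable (f : nat -> nat) : Prop :=
  exists p : program, forall k, exists t, runs_in p (enc_nat k) (enc_nat (f k)) t.

(* A problem has inputs in [I], and [spec x y] states that [y] is a correct
   output on [x]. The size is replaced by 1 when it is 0, for which the bound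
   [size x ^ c] would be 0. *)
Definition fpt (I O : Type) (encI : I -> tree) (encO : O -> tree)
    (size param : I -> nat) (spec : I -> O -> Prop) : Prop :=
  exists (p : program) (f : nat -> nat) (c : nat),
    computable f /\
    forall x : I, exists (y : O) (t : nat),
      [/\ spec x y, runs_in p (encI x) (encO y) t &
          t <= f (param x) * maxn 1 (size x) ^ c].

(** * The problem MB Dom Game *)

Record mb_instance := MBInstance {
  mb_order : nat;
  mb_graph : graph 'I_mb_order;
  mb_first : player }.

Definition enc_player (p : player) : tree :=
  match p with Dominator => enc_bool true | Staller => enc_bool false end.

(* The adjacency matrix, as the list of its rows. *)
Definition enc_graph (n : nat) (G : graph 'I_n) : tree :=
  enc_seq (fun i => enc_seq (fun j => enc_bool (adj G i j)) (enum 'I_n))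
          (enum 'I_n).

Definition enc_mb_instance (x : mb_instance) : tree :=
  Node (enc_player (mb_first x)) (enc_graph (mb_graph x)).

Definition mb_dom_game (x : mb_instance) (winner : player) : Prop :=
  has_winning_strategy (mb_graph x) (mb_first x) winner.

Definition mb_modular_width (x : mb_instance) : nat :=
  modular_width (mb_graph x).

(* Main.v *)
Require Import Defs.
From mathcomp Require Import all_boot.
From mathcomp Require Import boolp.
From mathcomp Require Import zify.

(* Let M be a module with at least two vertices. Whoever wins the game on G[M]
   is Dominator, Staller, or the first player, and this outcome is all that the
   rest of the graph sees of M: answering Staller inside M, Dominator always
   gets a vertex of M, so the neighbours of M are dominated for free, and what
   remains is whether M is dominated from inside. This is settled if Dominator
   or Staller wins on G[M]; otherwise it goes to the first player who moves in
   M, as if M were a single vertex. So M can be contracted to one vertex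
   labelled with its outcome.

   The algorithm repeatedly contracts a module of minimum size, found among the
   module closures of the pairs of vertices, after solving the game on it by
   exhaustive search. A minimum module M is prime, so for any modular
   decomposition all of M lies in one operand of each operation, or else in
   different operands of a single substitution; hence |M| <= max(2, mw(G)), and
   only the exhaustive search depends exponentially on mw(G). *)

Set Implicit Arguments.
Unset Strict Implicit.
Unset Printing Implicit Defensive.

(** * The game on a monotone family of sets *)

(** Half of each equivalence between a graph and its contraction says that Dominator does not win.
    For a monotone goal the opponent plays a game of the same kind, with the dual goal, and exactly
    one of the two wins. So two constructions of strategies suffice, one for disjoint boards and one
    for a board that simulates a single vertex; each statement on losing is one of them, applied to
    the opponent.

    A contracted module is represented by one of its own vertices, so every graph met by the
    algorithm is an induced subgraph of the input with labels on its vertices. Labels affect the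
    game but not the modules. Hence the width bound concerns only prime vertex sets of the input
    graph, and the modular-width of a contracted graph never enters. *)

Section PositionalGames.
Variable V : finType.
Implicit Types (W : {set V} -> bool) (U A B Z : {set V}).

(* The player owns [A], the vertices of [U] are unclaimed, the opponent is to
   move, and the player wants the set of all her claims to satisfy [W]. The
   player may pass and the opponent may not; for monotone [W] this does not
   change the winner, and no parity argument is needed to combine games. *)
Fixpoint second_wins_fuel n W U A : bool :=
  if U == set0 then W A else
  if n is n'.+1 then
    [forall x in U, second_wins_fuel n' W (U :\ x) A ||
      [exists y in U :\ x, second_wins_fuel n' W (U :\ x :\ y) (y |: A)]]
  else false.

Definition second_wins W U A := second_wins_fuel #|U| W U A.
Definition first_wins W U A :=
  second_wins W U A || [exists y in U, second_wins W (U :\ y) (y |: A)].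

Lemma second_wins_fuelE n W U A :
  #|U| <= n -> second_wins_fuel n W U A = second_wins W U A.
Proof.
rewrite /second_wins => leUn.
suff H k m (X B : {set V}) : #|X| <= k -> #|X| <= m ->
    second_wins_fuel k W X B = second_wins_fuel m W X B by apply: H.
elim: k m X B => [|k IH] [|m] X B hk hm //=.
- by move: hk; rewrite leqn0 cards_eq0 => ->.
- by move: hm; rewrite leqn0 cards_eq0 => ->.
case: eqP => // _.
apply: eq_forallb => x; apply: implyb_id2l => xX.
have lt1 : #|X :\ x| < #|X| by rewrite [X in _ < X](cardsD1 x) xX.
rewrite (IH m) ?(leq_trans lt1) //; last 2 first.
- by rewrite -ltnS (leq_trans lt1).
- by rewrite -ltnS (leq_trans lt1).
congr (_ || _); apply: eq_existsb => y; apply: andb_id2l => yX.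
have lt2 : #|X :\ x :\ y| < #|X|.
  by apply: leq_ltn_trans lt1; apply: subset_leq_card; apply: subD1set.
by apply: IH; rewrite -ltnS (leq_trans lt2).
Qed.

Lemma second_winsP W U A :
  reflect ((U = set0 -> W A) /\ forall x, x \in U -> first_wins W (U :\ x) A)
          (second_wins W U A).
Proof.
have E : second_wins W U A =
    if U == set0 then W A else [forall x in U, first_wins W (U :\ x) A].
  rewrite -(@second_wins_fuelE #|U|.+1) //=; case: eqP => // _.
  apply: eq_forallb => x; apply: implyb_id2l => xU.
  rewrite /first_wins second_wins_fuelE; last first.
    by apply: subset_leq_card; apply: subD1set.
  congr (_ || _); apply: eq_existsb => y; congr (_ && _).
  rewrite second_wins_fuelE //; apply: subset_leq_card.
  by rewrite (subset_trans (subD1set _ _)) // subD1set.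
rewrite E; apply: (iffP idP) => [|[h0 h1]].
  case: eqP => [->|ne] h; split => // x; first by rewrite inE.
  by move/forall_inP: h => /[apply].
by case: eqP => [/h0//|_]; apply/forall_inP.
Qed.

Lemma first_winsP W U A :
  reflect (second_wins W U A \/
           exists2 y, y \in U & second_wins W (U :\ y) (y |: A))
          (first_wins W U A).
Proof.
apply: (iffP orP) => -[h|h]; [by left|right|by left|right].
  by case/exists_inP: h => y; exists y.
by case: h => y yU h; apply/exists_inP; exists y.
Qed.

Lemma second_first W U A : second_wins W U A -> first_wins W U A.
Proof. by move=> h; apply/first_winsP; left. Qed.

Lemma first_wins_move W U A y :
  y \in U -> second_wins W (U :\ y) (y |: A) -> first_wins W U A.
Proof. by move=> yU h; apply/first_winsP; right; exists y. Qed.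

Lemma ltn_card_setD1 U x n : x \in U -> #|U| < n.+1 -> #|U :\ x| < n.
Proof. by move=> xU; rewrite (cardsD1 x) xU add1n ltnS. Qed.

Lemma setU1_subset U Z x : x \in U -> Z \subset U :\ x -> x |: Z \subset U.
Proof.
move=> xU ZU; rewrite subUset sub1set xU.
by rewrite (subset_trans ZU) ?subD1set.
Qed.

(* The player replies in the part where the opponent has just moved; where no
   reply is left she passes, which costs nothing in this formulation. *)
Lemma second_wins_disjoint W1 W2 W U1 U2 A1 A2 A :
  [disjoint U1 & U2] -> second_wins W1 U1 A1 -> second_wins W2 U2 A2 ->
  (forall Z1 Z2, Z1 \subset U1 -> Z2 \subset U2 ->
     W1 (Z1 :|: A1) -> W2 (Z2 :|: A2) -> W (Z1 :|: Z2 :|: A)) ->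
  second_wins W (U1 :|: U2) A.
Proof.
have [n] := ubnP #|U1 :|: U2|.
elim: n => // n IH in W1 W2 U1 U2 A1 A2 A *.
move=> ltn dU s1 s2 hW; apply/second_winsP; split=> [/eqP U0|].
  move: U0 s1 s2 hW; rewrite setU_eq0 => /andP[/eqP-> /eqP->].
  case/second_winsP=> /(_ erefl) w1 _ /second_winsP [/(_ erefl) w2 _].
  by move/(_ set0 set0); rewrite !set0U; apply.
(* One of the two symmetric cases of the opponent's move. *)
have key X1 X2 B1 B2 F1 F2 x : X1 :|: X2 = U1 :|: U2 -> [disjoint X1 & X2] ->
    second_wins F1 X1 B1 -> second_wins F2 X2 B2 ->
    (forall Z1 Z2, Z1 \subset X1 -> Z2 \subset X2 ->
       F1 (Z1 :|: B1) -> F2 (Z2 :|: B2) -> W (Z1 :|: Z2 :|: A)) ->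
    x \in X1 -> first_wins W ((U1 :|: U2) :\ x) A.
  move=> EX dX t1 t2 hF xX1.
  have xX2 : x \notin X2 by rewrite (disjointFr dX).
  have EU : (U1 :|: U2) :\ x = X1 :\ x :|: X2.
    by rewrite -EX setDUl; congr (_ :|: _); apply/setDidPl; rewrite disjoint_sym disjoints1.
  have dx : [disjoint X1 :\ x & X2] by apply: disjointWl dX; apply: subD1set.
  have ltx : #|X1 :\ x :|: X2| < n.
    by rewrite -EU; apply: ltn_card_setD1 ltn; rewrite -EX inE xX1.
  rewrite EU; case/second_winsP: t1 => _ /(_ x xX1) /first_winsP [t1|[y yX t1]].
    apply: second_first; apply: IH t1 t2 _ => // Z1 Z2 s1' s2'; apply: hF => //.
    by apply: subset_trans s1' _; apply: subD1set.
  have yX2 : y \notin X2 by rewrite (disjointFr dx).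
  have Ey : (X1 :\ x :|: X2) :\ y = X1 :\ x :\ y :|: X2.
    by rewrite setDUl; congr (_ :|: _); apply/setDidPl; rewrite disjoint_sym disjoints1.
  apply: (@first_wins_move _ _ _ y); first by rewrite inE yX.
  rewrite Ey; apply: IH t1 t2 _.
  - rewrite -Ey; apply: leq_ltn_trans ltx; apply: subset_leq_card; exact: subD1set.
  - by apply: disjointWl dx; apply: subD1set.
  move=> Z1 Z2 sZ1 sZ2 w1 w2.
  have -> : Z1 :|: Z2 :|: (y |: A) = y |: Z1 :|: Z2 :|: A.
    by rewrite setUCA !setUA.
  apply: hF => //; last by rewrite -setUA setUCA.
  by apply: (subset_trans _ (subD1set X1 x)); apply: setU1_subset.
move=> x; rewrite inE => /orP[xU1|xU2].
  exact: key erefl dU s1 s2 hW xU1.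
apply: key s2 s1 _ xU2; rewrite 1?setUC 1?disjoint_sym //.
by move=> Z2 Z1 sZ2 sZ1 w2 w1; rewrite [Z2 :|: _]setUC; apply: hW.
Qed.

Lemma second_wins_true W U A :
  (forall Z, Z \subset U -> W (Z :|: A)) -> second_wins W U A.
Proof.
have [n] := ubnP #|U|; elim: n => // n IH in U A *; move=> ltn h.
apply/second_winsP; split=> [U0|x xU].
  by rewrite -[A]set0U; apply: h; apply: sub0set.
apply: second_first; apply: IH; first exact: ltn_card_setD1.
by move=> Z ZU; apply: h; apply: subset_trans ZU _; apply: subD1set.
Qed.

(** The same strategy serves another goal: this is composition with an empty second board. *)
Lemma second_wins_sim W W' U A A' :
  second_wins W U A ->
  (forall Z, Z \subset U -> W (Z :|: A) -> W' (Z :|: A')) ->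
  second_wins W' U A'.
Proof.
move=> s h; rewrite -[U]setU0.
apply: (second_wins_disjoint _ s (W2 := fun=> true) (A2 := set0)).
- by rewrite -setI_eq0 setI0.
- exact: second_wins_true.
move=> Z1 Z2 ZU; rewrite subset0 => /eqP -> w _; rewrite setU0; exact: h.
Qed.

Lemma first_wins_sim W W' U A A' :
  first_wins W U A ->
  (forall Z, Z \subset U -> W (Z :|: A) -> W' (Z :|: A')) ->
  first_wins W' U A'.
Proof.
case/first_winsP=> [s|[y yU s]] h.
  by apply: second_first; apply: second_wins_sim s h.
apply: (first_wins_move yU); apply: second_wins_sim s _ => Z ZU w.
by rewrite setUCA setUA; apply: h; rewrite ?setU1_subset // -setUA setUCA.
Qed.

Lemma first_wins_disjoint W1 W2 W U1 U2 A1 A2 A :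
  [disjoint U1 & U2] -> first_wins W1 U1 A1 -> second_wins W2 U2 A2 ->
  (forall Z1 Z2, Z1 \subset U1 -> Z2 \subset U2 ->
     W1 (Z1 :|: A1) -> W2 (Z2 :|: A2) -> W (Z1 :|: Z2 :|: A)) ->
  first_wins W (U1 :|: U2) A.
Proof.
move=> dU /first_winsP[s1|[y yU1 s1]] s2 hW.
  by apply: second_first; apply: second_wins_disjoint s1 s2 hW.
have yU2 : y \notin U2 by rewrite (disjointFr dU).
apply: (@first_wins_move _ _ _ y); first by rewrite inE yU1.
have -> : (U1 :|: U2) :\ y = U1 :\ y :|: U2.
  by rewrite setDUl; congr (_ :|: _); apply/setDidPl; rewrite disjoint_sym disjoints1.
apply: (second_wins_disjoint _ s1 s2).
  by apply: disjointWl dU; apply: subD1set.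
move=> Z1 Z2 sZ1 sZ2 w1 w2.
have -> : Z1 :|: Z2 :|: (y |: A) = y |: Z1 :|: Z2 :|: A.
  by rewrite setUCA !setUA.
by apply: hW => //; [apply: setU1_subset | rewrite -setUA setUCA].
Qed.

Definition monotone W := forall A B, A \subset B -> W A -> W B.

(** Strategy stealing: the player who got [x] for free follows her old strategy and passes when it
    asks for [x]. *)
Lemma second_wins_extra W U A x :
  monotone W -> x \in U -> second_wins W U A ->
  second_wins W (U :\ x) (x |: A).
Proof.
move=> mW; have [n] := ubnP #|U|; elim: n => // n IH in U A *.
move=> ltn xU s; apply/second_winsP; split=> [U0|z].
  case/second_winsP: s => _ /(_ x xU); rewrite U0 => /first_winsP[|[y]].
    case/second_winsP=> /(_ erefl) wA _; apply: mW wA; exact: subsetUr.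
  by rewrite inE.
rewrite !inE => /andP[nzx zU].
have xUz : x \in U :\ z by rewrite !inE eq_sym nzx.
have ltz : #|U :\ z| < n by apply: ltn_card_setD1.
have Exz : U :\ x :\ z = U :\ z :\ x by rewrite !setDDl setUC.
rewrite Exz.
case/second_winsP: s => _ /(_ z zU) /first_winsP[s|[y yU s]].
  by apply: second_first; apply: IH.
case: (eqVneq y x) s => [->|nyx] s; first exact: second_first.
apply: (@first_wins_move _ _ _ y); first by rewrite 3!inE nyx; move: yU; rewrite !inE.
have -> : U :\ z :\ x :\ y = U :\ z :\ y :\ x by rewrite setDDl [[set x] :|: _]setUC -setDDl.
rewrite setUCA; apply: IH => //.
  by apply: leq_trans ltz; rewrite ltnS; apply: subset_leq_card; apply: subD1set.
by rewrite 2!inE xUz eq_sym nyx.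
Qed.

Lemma first_wins_extra W U A : monotone W -> U != set0 -> first_wins W U A ->
  exists2 y, y \in U & second_wins W (U :\ y) (y |: A).
Proof.
move=> mW /set0Pn[x xU] /first_winsP[s|//].
by exists x => //; apply: second_wins_extra.
Qed.

(* The goal of the opponent, who gets the complement. *)
Definition dual W B := ~~ W (~: B).

Lemma dual_monotone W : monotone W -> monotone (dual W).
Proof.
move=> mW A B AB; apply: contra; apply: mW; by rewrite setCS.
Qed.

Lemma dualK W : dual (dual W) =1 W.
Proof. by move=> A; rewrite /dual negbK setCK. Qed.

Lemma setC_U_D1 U A x : x \in U -> [disjoint U & A] ->
  ~: (U :\ x :|: A) = x |: ~: (U :|: A) /\ ~: (U :\ x :|: (x |: A)) = ~: (U :|: A).
Proof.
move=> xU dUA; have xA : x \notin A by rewrite (disjointFr dUA).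
split; apply/setP=> z; rewrite !inE; case: eqP => [->|_] //=; rewrite ?xU ?(negbTE xA) //.
Qed.

(** Determinacy of a finite game. The opponent owns everything outside [U] and [A]. *)
Lemma first_wins_dual_aux n W U A : #|U| < n -> monotone W -> [disjoint U & A] ->
  first_wins (dual W) U (~: (U :|: A)) = ~~ second_wins W U A.
Proof.
elim: n => // n IH in W U A *; move=> ltn mW dUA.
have mD := dual_monotone mW.
case: (eqVneq U set0) => [U0|Un0].
  rewrite U0 set0U; apply/idP/idP.
    case/first_winsP=> [/second_winsP[/(_ erefl)]|[y]]; last by rewrite inE.
    rewrite /dual setCK => nw _; apply/negP => /second_winsP[/(_ erefl)].
    by rewrite (negbTE nw).
  move=> ns; apply: second_first; apply/second_winsP; split => [_|x]; last by rewrite inE.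
  rewrite /dual setCK; apply: contra ns => w; apply/second_winsP; split => // x.
  by rewrite inE.
have step x : x \in U ->
    second_wins (dual W) (U :\ x) (x |: ~: (U :|: A)) = ~~ first_wins W (U :\ x) A.
  move=> xU; have [E1 E2] := setC_U_D1 xU dUA.
  have ltx := ltn_card_setD1 xU ltn.
  have dx : [disjoint U :\ x & A] by apply: disjointWl dUA; apply: subD1set.
  have dx' : [disjoint U :\ x & ~: (U :\ x :|: A)].
    by rewrite disjoints_subset setCK subsetUl.
  (* The induction hypothesis is applied to the opponent's game, whose own dual is the game for [W]
     again by [dualK]. *)
  rewrite -E1; have := IH _ _ _ ltx mD dx'.
  have -> : ~: (U :\ x :|: ~: (U :\ x :|: A)) = A.
    apply/setP=> z; rewrite !inE; have := disjointFr dx (x := z); rewrite !inE.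
    by case: (z == x); case: (z \in U); case: (z \in A) => //= /(_ erefl).
  move=> /esym/(canRL negbK) ->; congr (~~ _).
  apply/idP/idP => h; apply: first_wins_sim h _ => Z _; by rewrite dualK.
apply/idP/idP.
  (* The opponent may pass in [first_wins] but must move in [second_wins W]; a pass is replaced by a
     move, which does no harm. *)
  case/(first_wins_extra mD Un0) => y yU; rewrite step // => nf.
  apply: contra nf => /second_winsP[_]; exact.
move=> ns; suff /exists_inP[x xU nf] : [exists x in U, ~~ first_wins W (U :\ x) A].
  by apply: (first_wins_move xU); rewrite step.
apply: contraR ns; rewrite negb_exists_in => /forall_inP h.
apply/second_winsP; split=> [U0|x /h]; last by rewrite negbK.
by rewrite U0 eqxx in Un0.
Qed.

Lemma first_wins_dual W U : monotone W ->
  first_wins (dual W) U (~: U) = ~~ second_wins W U set0.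
Proof.
move=> mW; rewrite -[in ~: U](setU0 U); apply: (@first_wins_dual_aux #|U|.+1) => //.
by rewrite disjoint_sym -setI_eq0 set0I.
Qed.

Lemma second_wins_dual W U : monotone W ->
  second_wins (dual W) U (~: U) = ~~ first_wins W U set0.
Proof.
move=> mW.
have d : [disjoint U & ~: U] by rewrite disjoints_subset setCK.
have := first_wins_dual_aux (ltnSn #|U|) (dual_monotone mW) d.
rewrite setUCr setCT => /esym/(canRL negbK) ->; congr (~~ _).
by apply/idP/idP => h; apply: first_wins_sim h _ => Z _; rewrite dualK.
Qed.

End PositionalGames.

(** * A board that simulates a single vertex *)

Section Substitution.
Variable V : finType.
Implicit Types (W : {set V} -> bool) (U A B Z R : {set V}).

(* The module [M] simulates the vertex [x]: moving first in [M] wins [W1] there,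
   and [W0] can be secured in [M] even after the opponent has moved first. *)
Section OneVertex.
Variables (x : V) (M : {set V}) (W W0 W1 W2 : {set V} -> bool).
Hypothesis Mn0 : M != set0.
Hypothesis M_first : first_wins W1 M set0.
Hypothesis M_lost : forall m, m \in M -> second_wins W0 (M :\ m) set0.

(** [A] are the claims in the real game and [A2] those in the simulated one, where [x] stands for
    all of [M]: owning [x] is worth [W1] on [M], losing it [W0]. *)
Let compat R A A2 :=
  (forall Z1 Z2, Z1 \subset M -> Z2 \subset R ->
     W1 Z1 -> W2 (x |: (Z2 :|: A2)) -> W (Z1 :|: Z2 :|: A)) /\
  (forall Z1 Z2, Z1 \subset M -> Z2 \subset R ->
     W0 Z1 -> W2 (Z2 :|: A2) -> W (Z1 :|: Z2 :|: A)).

Let compatD R A A2 y : compat R A A2 -> compat (R :\ y) A A2.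
Proof.
have s := subD1set R y.
case=> h1 h0; split=> Z1 Z2 s1 s2; [apply: h1|apply: h0] => //; exact: subset_trans s2 s.
Qed.

Let compatU R A A2 y :
  y \in R -> compat R A A2 -> compat (R :\ y) (y |: A) (y |: A2).
Proof.
move=> yR [h1 h0]; split=> Z1 Z2 s1 s2 w w2; rewrite -!setUA (setUCA Z2) [y |: (_ :|: _)]setUA setUA.
  by apply: h1; rewrite ?setU1_subset // -setUA (setUCA _ Z2).
by apply: h0; rewrite ?setU1_subset // -setUA (setUCA _ Z2).
Qed.

(** The strategy asks for [x]: the player takes the first move in [M], and from then on [M] and [R]
    are separate boards. *)
Let mine R A A2 : [disjoint M & R] -> compat R A A2 ->
  second_wins W2 R (x |: A2) -> first_wins W (M :|: R) A.
Proof.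
move=> dMR [h1 _] s2; apply: (first_wins_disjoint dMR M_first s2) => Z1 Z2 s1 s2'.
rewrite setU0 => w1 w2; apply: h1 => //; by rewrite setUCA in w2.
Qed.

(** While [M] is untouched the player follows the strategy on [x |: R]. A move of the opponent in
    [M] counts as claiming [x]; when the strategy asks for [x], [mine] applies. *)
Lemma second_wins_subst R A A2 :
  x \notin R -> [disjoint M & R] -> compat R A A2 ->
  second_wins W2 (x |: R) A2 -> second_wins W (M :|: R) A.
Proof.
have [n] := ubnP #|R|; elim: n => // n IH in R A A2 *.
move=> ltn xR dMR C s2; apply/second_winsP; split.
  by move/eqP; rewrite setU_eq0 (negbTE Mn0).
move=> z; rewrite inE; case: (boolP (z \in M)) => [zM _|zM /= zR].
  have zR : z \notin R by rewrite (disjointFr dMR).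
  have -> : (M :|: R) :\ z = R :|: M :\ z.
    by rewrite setUC setDUl; congr (_ :|: _); apply/setDidPl; rewrite disjoint_sym disjoints1.
  case/second_winsP: s2 => _ /(_ x); rewrite setU11 => /(_ isT).
  rewrite setU1K // => s2; apply: (first_wins_disjoint _ s2 (M_lost zM)).
    by rewrite disjoint_sym; apply: disjointWl dMR; apply: subD1set.
  move=> Z2 Z1 sZ2 sZ1 w2; rewrite setU0 [Z2 :|: Z1]setUC => w1.
  by apply: (C.2) => //; apply: subset_trans sZ1 _; apply: subD1set.
have nzx : z != x by apply: contraNneq xR => <-.
have zMR : M :\ z = M by apply/setDidPl; rewrite disjoint_sym disjoints1.
have dz : [disjoint M & R :\ z] by apply: disjointWr dMR; apply: subD1set.
have xz : x \notin R :\ z by rewrite !inE negb_and xR orbT.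
have ltz := ltn_card_setD1 zR ltn.
rewrite setDUl zMR.
case/second_winsP: s2 => _ /(_ z); rewrite inE zR orbT => /(_ isT).
have -> : (x |: R) :\ z = x |: R :\ z.
  by rewrite setDUl; congr (_ :|: _); apply/setDidPl; rewrite disjoints1 !inE eq_sym.
case/first_winsP=> [s2|[y]].
  by apply: second_first; apply: IH s2 => //; apply: compatD.
case: (eqVneq y x) => [->|nyx] yxR.
  rewrite setU1K // => s2; apply: mine s2 => //; exact: compatD.
have yR : y \in R :\ z by move: yxR; rewrite in_setU1 (negbTE nyx).
have -> : (x |: R :\ z) :\ y = x |: R :\ z :\ y.
  by rewrite setDUl; congr (_ :|: _); apply/setDidPl; rewrite disjoints1 !inE eq_sym.
move=> s2; apply: (first_wins_move (y := y)); first by rewrite inE yR orbT.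
rewrite setDUl.
have -> : M :\ y = M by apply/setDidPl; rewrite disjoint_sym disjoints1 (disjointFl dz).
apply: IH s2.
- by apply: leq_ltn_trans ltz; apply: subset_leq_card; apply: subD1set.
- by rewrite inE negb_and xz orbT.
- by apply: disjointWr dz; apply: subD1set.
- by apply: compatU => //; apply: compatD.
Qed.

Lemma first_wins_subst R A A2 :
  x \notin R -> [disjoint M & R] -> compat R A A2 ->
  first_wins W2 (x |: R) A2 -> first_wins W (M :|: R) A.
Proof.
move=> xR dMR C /first_winsP[s2|[y]].
  by apply: second_first; apply: second_wins_subst s2.
case: (eqVneq y x) => [->|nyx] yxR.
  by rewrite setU1K // => s2; apply: mine s2.
have yR : y \in R by move: yxR; rewrite in_setU1 (negbTE nyx).
have -> : (x |: R) :\ y = x |: R :\ y.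
  by rewrite setDUl; congr (_ :|: _); apply/setDidPl; rewrite disjoints1 !inE eq_sym.
move=> s2; apply: (first_wins_move (y := y)); first by rewrite inE yR orbT.
rewrite setDUl.
have -> : M :\ y = M by apply/setDidPl; rewrite disjoint_sym disjoints1 (disjointFl dMR).
apply: second_wins_subst s2.
- by rewrite inE negb_and xR orbT.
- by apply: disjointWr dMR; apply: subD1set.
- exact: compatU.
Qed.

End OneVertex.
End Substitution.

Lemma subset_implb (T : finType) (A B : {set T}) z :
  A \subset B -> (z \in A) ==> (z \in B).
Proof. by move=> /subsetP h; apply/implyP; apply: h. Qed.

Lemma disjoint_nandb (T : finType) (A B : {set T}) z :
  [disjoint A & B] -> ~~ ((z \in A) && (z \in B)).
Proof. by move=> h; case: (boolP (z \in A)) => //= /(disjointFr h)->. Qed.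

(* Decides an identity of sets pointwise, by truth tables, using the inclusions
   and disjointness statements of the context. *)
Ltac set_tauto := let z := fresh "z" in
  apply/setP => z; rewrite !inE;
  repeat match goal with
  | H : is_true (?A \subset ?B) |- _ =>
      move: (subset_implb z H); clear H; rewrite ?inE
  | H : is_true [disjoint ?A & ?B] |- _ =>
      move: (disjoint_nandb z H); clear H; rewrite ?inE
  end;
  repeat match goal with |- context [z \in ?A] => case: (z \in A) => //= end.

(** * Lost games, by duality *)

Section SecondPlayerLoses.
Variable V : finType.
Implicit Types (w : {set V} -> bool) (U A B Z R : {set V}).

(** If a win on the union forces a win on one of the parts, an opponent who spoils both parts spoils
    the union: this is the composition condition for the dual goals. *)
Lemma disjoint_dual_cond w w1 w2 U1 U2 : [disjoint U1 & U2] ->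
  (forall Z, Z \subset U1 :|: U2 -> w Z -> w1 (Z :&: U1) \/ w2 (Z :&: U2)) ->
  forall Z1 Z2, Z1 \subset U1 -> Z2 \subset U2 ->
  dual w1 (Z1 :|: ~: U1) -> dual w2 (Z2 :|: ~: U2) ->
  dual w (Z1 :|: Z2 :|: ~: (U1 :|: U2)).
Proof.
move=> dU h Z1 Z2 sZ1 sZ2; rewrite /dual => n1 n2; apply/negP.
have sY : ~: (Z1 :|: Z2 :|: ~: (U1 :|: U2)) \subset U1 :|: U2.
  by apply/subsetP=> z; rewrite !inE negb_or negbK => /andP[].
have E1 : ~: (Z1 :|: Z2 :|: ~: (U1 :|: U2)) :&: U1 = ~: (Z1 :|: ~: U1).
  by clear sY; set_tauto.
have E2 : ~: (Z1 :|: Z2 :|: ~: (U1 :|: U2)) :&: U2 = ~: (Z2 :|: ~: U2).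
  by clear sY E1; set_tauto.
by case/(h _ sY); rewrite ?E1 ?E2; apply/negP.
Qed.

Lemma not_first_wins_disjoint w w1 w2 U1 U2 :
  monotone w -> monotone w1 -> monotone w2 -> [disjoint U1 & U2] ->
  (forall Z, Z \subset U1 :|: U2 -> w Z -> w1 (Z :&: U1) \/ w2 (Z :&: U2)) ->
  ~~ first_wins w1 U1 set0 -> ~~ first_wins w2 U2 set0 ->
  ~~ first_wins w (U1 :|: U2) set0.
Proof.
move=> mw m1 m2 dU h; rewrite -!second_wins_dual // => s1 s2.
exact: (second_wins_disjoint dU s1 s2 (disjoint_dual_cond dU h)).
Qed.

Lemma not_second_wins_disjoint w w1 w2 U1 U2 :
  monotone w -> monotone w1 -> monotone w2 -> [disjoint U1 & U2] ->
  (forall Z, Z \subset U1 :|: U2 -> w Z -> w1 (Z :&: U1) \/ w2 (Z :&: U2)) ->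
  ~~ second_wins w1 U1 set0 -> ~~ first_wins w2 U2 set0 ->
  ~~ second_wins w (U1 :|: U2) set0.
Proof.
move=> mw m1 m2 dU h; rewrite -second_wins_dual // -!first_wins_dual // => s1 s2.
exact: (first_wins_disjoint dU s1 s2 (disjoint_dual_cond dU h)).
Qed.

Section Subst.
Variables (x : V) (M R : {set V}) (w b w2 : {set V} -> bool).
Hypotheses (mw : monotone w) (mb : monotone b) (mw2 : monotone w2).
Hypotheses (Mn0 : M != set0) (xR : x \notin R) (dMR : [disjoint M & R]).
Hypothesis b_lost : ~~ second_wins b M set0.
Hypothesis h1 : forall Z, Z \subset M :|: R -> w Z -> w2 (x |: Z :&: R).
Hypothesis h0 : forall Z, Z \subset M :|: R -> w Z ->
  b (Z :&: M) \/ w2 (Z :&: R).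

(** Now the opponent lets [M] simulate [x]. Moving first in [M] is enough to spoil [b], by [b_lost];
    once the player has moved first there, the opponent's goal on [M] is [true], since [h1] grants
    [x] to the player. *)
Let W1 Z := dual b (Z :|: ~: M).

Let first1 : first_wins W1 M set0.
Proof.
have := b_lost; rewrite -first_wins_dual // => s.
by apply: first_wins_sim s _ => Z _; rewrite /W1 setU0.
Qed.

Let lost m : m \in M -> second_wins (fun=> true) (M :\ m) set0.
Proof. by move=> _; apply: second_wins_true. Qed.

Let c1 Z1 Z2 : Z1 \subset M -> Z2 \subset R ->
  W1 Z1 -> dual w2 (x |: (Z2 :|: ~: (x |: R))) ->
  dual w (Z1 :|: Z2 :|: ~: (M :|: R)).
Proof.
move=> s1 s2; rewrite /W1 /dual => n1 n2; apply/negP.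
have sY : ~: (Z1 :|: Z2 :|: ~: (M :|: R)) \subset M :|: R.
  by apply/subsetP=> z; rewrite !inE negb_or negbK => /andP[].
have sx : R \subset ~: [set x] by rewrite subsetC sub1set inE.
have E1 : ~: (Z1 :|: Z2 :|: ~: (M :|: R)) :&: M = ~: (Z1 :|: ~: M).
  by clear sY sx; set_tauto.
have E2 : ~: (Z1 :|: Z2 :|: ~: (M :|: R)) :&: R = ~: (x |: (Z2 :|: ~: (x |: R))).
  clear sY E1; set_tauto; by case: (z == x).
by case/(h0 sY); rewrite ?E1 ?E2; apply/negP.
Qed.

Let c0 Z1 Z2 : Z1 \subset M -> Z2 \subset R ->
  true -> dual w2 (Z2 :|: ~: (x |: R)) ->
  dual w (Z1 :|: Z2 :|: ~: (M :|: R)).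
Proof.
move=> s1 s2 _; rewrite /dual; apply: contra.
have sY : ~: (Z1 :|: Z2 :|: ~: (M :|: R)) \subset M :|: R.
  by apply/subsetP=> z; rewrite !inE negb_or negbK => /andP[].
have sx : R \subset ~: [set x] by rewrite subsetC sub1set inE.
have E2 : x |: ~: (Z1 :|: Z2 :|: ~: (M :|: R)) :&: R = ~: (Z2 :|: ~: (x |: R)).
  clear sY; set_tauto; by case: (z == x).
by move/(h1 sY); rewrite E2.
Qed.

Lemma not_first_wins_subst :
  ~~ first_wins w2 (x |: R) set0 -> ~~ first_wins w (M :|: R) set0.
Proof.
rewrite -!second_wins_dual // => s.
apply: (second_wins_subst Mn0 first1 lost xR dMR _ s); split; [exact: c1|exact: c0].
Qed.

Lemma not_second_wins_subst :
  ~~ second_wins w2 (x |: R) set0 -> ~~ second_wins w (M :|: R) set0.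
Proof.
rewrite -!first_wins_dual // => s.
apply: (first_wins_subst Mn0 first1 lost xR dMR _ s); split; [exact: c1|exact: c0].
Qed.

End Subst.

Lemma second_wins_hit U : 1 < #|U| -> second_wins (fun Z => Z != set0) U set0.
Proof.
move=> lt1; apply/second_winsP; split=> [U0|x xU].
  by move: lt1; rewrite U0 cards0.
move: lt1; rewrite (cardsD1 x) xU ltnS card_gt0 => /set0Pn[y yU].
apply: (first_wins_move yU); apply: second_wins_true => Z _.
by apply/set0Pn; exists y; rewrite !inE eqxx !orbT.
Qed.

End SecondPlayerLoses.

(** * Contracting a module *)

(* [Plain] marks a vertex of the original graph; the other labels mark a
   contracted module with at least two vertices by the winner of the game on
   it: Dominator, the first player, or Staller, whoever starts. *)
Inductive label := Plain | DominatorWins | FirstWins | StallerWins.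

(** What the rest of the graph sees of a module: a big vertex dominates its neighbours for free, a
    claimable one is still fought for, a needy one is not dominated from inside unless it is
    claimed. [Plain] and [FirstWins] differ only in the first bit. *)
Definition is_big o := if o is Plain then false else true.
Definition is_claimable o :=
  match o with Plain | FirstWins => true | _ => false end.
Definition is_needy o := if o is DominatorWins then false else true.

Section Contraction.
Variables (V : finType) (G : graph V).
Implicit Types (l : V -> label) (X M Y Z : {set V}).

Definition claimables l X := [set x in X | is_claimable (l x)].

Definition hits l Z u := is_big (l u) || (u \in Z).

Definition label_dominating l X Z :=
  [forall v in X, [|| ~~ is_needy (l v), v \in Z |
                      [exists u in X, adj G v u && hits l Z u]]].

Lemma label_dominatingP l X Z :
  reflect (forall v, v \in X -> is_needy (l v) -> v \notin Z ->
             exists2 u, u \in X & adj G v u /\ hits l Z u)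
          (label_dominating l X Z).
Proof.
apply: (iffP forall_inP) => h v vX.
  move=> nv vZ; move: (h v vX); rewrite nv (negbTE vZ) /=.
  by case/exists_inP=> u uX /andP[]; exists u.
case: (boolP (is_needy _)) => //= nv; case: (boolP (v \in Z)) => //= vZ.
by apply/exists_inP; case: (h v vX nv vZ) => u uX [a hu]; exists u => //; apply/andP.
Qed.

Lemma label_dominating_monotone l X : monotone (label_dominating l X).
Proof.
move=> A B AB /label_dominatingP h; apply/label_dominatingP => v vX nv vB.
case: (h v vX nv); first by apply: contra vB => /(subsetP AB).
move=> u uX [a /orP hu]; exists u => //; split=> //; apply/orP.
by case: hu => [|/(subsetP AB)]; [left|right].
Qed.

Definition dom_second l X :=
  second_wins (label_dominating l X) (claimables l X) set0.
Definition dom_first l X :=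
  first_wins (label_dominating l X) (claimables l X) set0.

Definition outcome l X :=
  if dom_second l X then DominatorWins
  else if dom_first l X then FirstWins else StallerWins.

Definition is_module_in X M :=
  [forall w in X :\: M, forall u in M, forall v in M, adj G w u == adj G w v].

Lemma is_module_inP X M w u v : is_module_in X M ->
  w \in X -> w \notin M -> u \in M -> v \in M -> adj G w u = adj G w v.
Proof.
move=> /forall_inP h wX wM uM vM; apply/eqP; move: (h w); rewrite inE wM.
by move/(_ wX)/forall_inP/(_ u uM)/forall_inP; apply.
Qed.

Section OneModule.
Variables (l : V -> label) (X M : {set V}) (m0 : V).
Hypotheses (MX : M \subset X) (mod : is_module_in X M).
Hypotheses (M_gt1 : 1 < #|M|) (m0M : m0 \in M).

Definition relabel o := fun v => if v == m0 then o else l v.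
Definition contract := m0 |: (X :\: M).

Let R := claimables l (X :\: M).
Let b := label_dominating l M.
Let b' o := label_dominating (relabel o) contract.
(** A vertex outside [M] with a neighbour in [M] is adjacent to all of [M], so a single hit in [M]
    dominates all such vertices. *)
Let a Z := [exists u in M, hits l Z u].

Let relabelE o v : v \notin M -> relabel o v = l v.
Proof. by rewrite /relabel; case: eqP => // ->; rewrite m0M. Qed.

Let mod' w u : w \in X -> w \notin M -> u \in M -> adj G w u = adj G w m0.
Proof. by move=> wX wM uM; apply: is_module_inP mod _ _ _ _. Qed.

(** A vertex outside [M] adjacent to [m0] is adjacent to the vertex of [M] that hits. If [M] is not
    dominated from inside, [m0] is needy and unclaimed, so it has a neighbour outside that hits, and
    this one dominates all of [M]. *)
Lemma dominating_lift o Z1 Z2 Z :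
  is_big o -> Z \subset m0 |: Z2 -> a Z1 -> b' o Z ->
  b Z1 || is_needy o && (m0 \notin Z) -> label_dominating l X (Z1 :|: Z2).
Proof.
move=> big sZ /exists_inP[h hM hh] /label_dominatingP h' alt.
have hit u : hits l Z1 u -> hits l (Z1 :|: Z2) u.
  by rewrite /hits inE => /orP[->//|->]; rewrite orbT.
have hit' u : u \in X :\: M -> hits (relabel o) Z u -> hits l (Z1 :|: Z2) u.
  rewrite inE => /andP[uM uX]; rewrite /hits relabelE // => /orP[->//|uZ].
  move: (subsetP sZ _ uZ); rewrite !inE; case: eqP => [e|_ /= ->]; last by rewrite !orbT.
  by rewrite e m0M in uM.
apply/label_dominatingP => v vX nv; rewrite inE negb_or => /andP[vZ1 vZ2].
case: (boolP (v \in M)) => vM.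
  case/orP: alt => [/label_dominatingP hb|/andP[no m0Z]].
    case: (hb v vM nv vZ1) => u uM [avu hu]; exists u; first exact: (subsetP MX).
    by split => //; apply: hit.
  case: (h' m0); rewrite ?setU11 //; first by rewrite /relabel eqxx.
  move=> u; rewrite in_setU1 => /orP[/eqP->|uXM]; first by rewrite adj_irr => -[].
  case=> amu hu; have := uXM; rewrite inE => /andP[uM uX].
  exists u => //; split; last exact: hit'.
  by rewrite adj_sym (mod' uX uM) // adj_sym.
have vXM : v \in X :\: M by rewrite inE vM.
have nvm : v != m0 by apply: contraNneq vM => ->.
case: (h' v); rewrite ?relabelE //; first by rewrite in_setU1 vXM orbT.
  by apply: contra vZ2 => /(subsetP sZ); rewrite in_setU1 (negbTE nvm).
move=> u; rewrite in_setU1 => /orP[/eqP->|uXM] [avu hu].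
  by exists h; [apply: (subsetP MX)|split; [rewrite mod'|apply: hit]].
exists u; last by split => //; apply: hit'.
by move: uXM; rewrite inE => /andP[].
Qed.

(** If [Y] does not dominate [M] from inside, some vertex of [M] is dominated from outside, by a
    vertex that is adjacent to [m0] as well. *)
Lemma dominating_drop o Y Z :
  is_big o -> Y :\: M \subset Z -> label_dominating l X Y ->
  [|| ~~ is_needy o, m0 \in Z | ~~ b Y] -> b' o Z.
Proof.
move=> big sY /label_dominatingP h alt.
have hit u : u \in X -> u \notin M -> hits l Y u -> hits (relabel o) Z u.
  move=> uX uM; rewrite /hits relabelE // => /orP[->//|uY].
  by rewrite (subsetP sY) ?orbT // inE uM.
apply/label_dominatingP => v; rewrite in_setU1 => /orP[/eqP->|].
  rewrite /relabel eqxx => no m0Z; move: alt; rewrite no (negbTE m0Z) /= => nb.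
  have : [exists v in M, [&& is_needy (l v), v \notin Y &
                            [forall u in M, adj G v u ==> ~~ hits l Y u]]].
    apply: contraR nb; rewrite negb_exists_in => /forall_inP nb.
    apply/label_dominatingP => x xM nx xY; move: (nb x xM); rewrite nx xY /=.
    by rewrite negb_forall_in => /exists_inP[u uM]; rewrite negb_imply negbK => /andP[]; exists u.
  case/exists_inP=> x xM /and3P[nx xY /forall_inP hx].
  case: (h x (subsetP MX _ xM) nx xY) => u uX [avu hu].
  have uM : u \notin M by apply/negP => /hx; rewrite avu hu.
  exists u; first by rewrite !inE uM uX orbT.
  by split; [rewrite adj_sym -(mod' uX uM xM) adj_sym | apply: hit].
rewrite inE => /andP[vM vX]; rewrite relabelE // => nv vZ.
have vY : v \notin Y by apply: contra vZ => vY; rewrite (subsetP sY) // inE vM.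
case: (h v vX nv vY) => u uX [avu hu].
case: (boolP (u \in M)) => uM.
  exists m0; first by rewrite setU11.
  by rewrite -(mod' vX vM uM) /hits /relabel eqxx big.
by exists u; [rewrite !inE uM uX orbT | split=> //; apply: hit].
Qed.

Let claimablesE : claimables l X = claimables l M :|: R.
Proof.
apply/setP=> z; rewrite !inE; case: (boolP (z \in M)) => [/(subsetP MX)->|_] //=.
by rewrite orbF.
Qed.

Let claimables'E o :
  claimables (relabel o) contract = if is_claimable o then m0 |: R else R.
Proof.
apply/setP=> z; have -> : (z \in if is_claimable o then m0 |: R else R) =
    if is_claimable o then z \in m0 |: R else z \in R by case: ifP.
rewrite !inE /relabel; case: eqP => [->|_] /=; rewrite ?m0M ?if_same //=.
by case: is_claimable.
Qed.

Let dMR : [disjoint claimables l M & R].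
Proof.
rewrite disjoints_subset; apply/subsetP=> z.
by rewrite !inE => /andP[zM _]; rewrite zM.
Qed.

Let m0R : m0 \notin R. Proof. by rewrite !inE m0M. Qed.

Let b_a Z : b Z -> a Z.
Proof.
move=> /label_dominatingP h; apply/exists_inP.
case: (boolP (hits l Z m0)) => [|nh]; first by exists m0.
move: nh; rewrite negb_or => /andP[nb nZ].
by case: (h m0 m0M _ nZ) => [|u uM [_ hu]]; [case: (l m0) nb | exists u].
Qed.

Let cap_drop Y : Y \subset claimables l M :|: R -> b Y -> b (Y :&: claimables l M).
Proof.
move=> sY /label_dominatingP h.
have in_cap u : u \in M -> u \in Y -> u \in Y :&: claimables l M.
  by move=> uM uY; move: (subsetP sY u uY); rewrite !inE uY uM /= orbF.
apply/label_dominatingP=> v vM nv vY.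
case: (h v vM nv); first by apply: contra vY; apply: in_cap.
move=> u uM [avu /orP hu]; exists u => //; split=> //; apply/orP.
by case: hu => [|/(in_cap _ uM)]; [left|right].
Qed.

Let drop_sub Y : Y \subset claimables l M :|: R -> Y :\: M \subset Y :&: R.
Proof.
move=> sY; apply/subsetP=> z; rewrite inE => /andP[zM zY].
by case/setUP: (subsetP sY z zY) => [|zR]; rewrite inE ?(negbTE zM) // zY zR.
Qed.

Let mb : monotone (label_dominating l M) := @label_dominating_monotone l M.
Let mW : monotone (label_dominating l X) := @label_dominating_monotone l X.
Let mb' : forall o, monotone (b' o) :=
  fun o => @label_dominating_monotone (relabel o) contract.
Let mfalse : monotone (fun _ : {set V} => false). Proof. by []. Qed.

(** For a module won by Dominator, nothing achieved in [M] can replace a win on the contraction: in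
    the converse direction its board gets an unattainable goal. *)
Let nfalse U : ~~ first_wins (fun _ : {set V} => false) U set0.
Proof.
by rewrite -second_wins_dual //; apply: second_wins_true.
Qed.

Lemma contract_DominatorWins : dom_second l M ->
  dom_second (relabel DominatorWins) contract = dom_second l X /\
  dom_first (relabel DominatorWins) contract = dom_first l X.
Proof.
rewrite /dom_second /dom_first claimablesE claimables'E /= => s.
have C Z1 Z2 : Z1 \subset claimables l M -> Z2 \subset R ->
    b (Z1 :|: set0) -> b' DominatorWins (Z2 :|: set0) ->
    label_dominating l X (Z1 :|: Z2 :|: set0).
  rewrite !setU0 => _ _ hb hb'; apply: (dominating_lift (o := DominatorWins) (Z := Z2)) => //.
  - exact: subsetUr.
  - exact: b_a.
  by rewrite hb.
have C' Z : Z \subset claimables l M :|: R -> label_dominating l X Z ->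
    false \/ b' DominatorWins (Z :&: R).
  by move=> sZ hZ; right; apply: (dominating_drop _ _ hZ) => //; apply: drop_sub.
have C2 Z1 Z2 : Z1 \subset R -> Z2 \subset claimables l M ->
    b' DominatorWins (Z1 :|: set0) -> b (Z2 :|: set0) ->
    label_dominating l X (Z1 :|: Z2 :|: set0).
  by move=> s1 s2 w1 w2; rewrite [Z1 :|: _]setUC; apply: C.
have nS := nfalse (claimables l M).
split; apply/idP/idP.
- by move=> s2; apply: (second_wins_disjoint dMR s s2).
- apply: contraLR => n2; rewrite setUC.
  apply: (not_second_wins_disjoint mW (@mb' _) mfalse _ _ n2 nS).
    by rewrite disjoint_sym.
  by move=> Z; rewrite setUC => sZ /(C' _ sZ) []; [right|left].
- by move=> s2; rewrite setUC; apply: (first_wins_disjoint _ s2 s) => //; rewrite disjoint_sym.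
- by apply: contraLR => n2; apply: (not_first_wins_disjoint mW mfalse (@mb' _) dMR C' nS n2).
Qed.

(** Either a contracted vertex of [M] hits for free, or all of [M] can be claimed and a vertex is
    left after Staller's move. *)
Let second_a : second_wins a (claimables l M) set0.
Proof.
case: (boolP [exists u in M, is_big (l u)]) => [/exists_inP[u uM bu]|].
  by apply: second_wins_true => Z _; apply/exists_inP; exists u; rewrite // /hits bu.
rewrite negb_exists_in => /forall_inP nb.
have -> : claimables l M = M.
  by apply/setP=> z; rewrite inE; case: (boolP (z \in M)) => //= /nb; case: (l z).
apply: second_wins_sim (second_wins_hit M_gt1) _ => Z sZ /set0Pn[u].
rewrite setU0 => uZ; apply/exists_inP; exists u; first exact: (subsetP sZ).
by rewrite /hits uZ orbT.
Qed.

(** Dominator plays in [M] only to hit it. Conversely Staller, who wins on [M] even when Dominator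
    starts there, keeps it from being dominated from inside, so that only its neighbours outside can
    help. *)
Lemma contract_StallerWins : ~~ dom_first l M ->
  dom_second (relabel StallerWins) contract = dom_second l X /\
  dom_first (relabel StallerWins) contract = dom_first l X.
Proof.
rewrite /dom_second /dom_first claimablesE claimables'E /= => ns.
have C Z1 Z2 : Z1 \subset claimables l M -> Z2 \subset R ->
    a (Z1 :|: set0) -> b' StallerWins (Z2 :|: set0) ->
    label_dominating l X (Z1 :|: Z2 :|: set0).
  rewrite !setU0 => _ s2 ha hb'; apply: (dominating_lift (o := StallerWins) (Z := Z2)) => //.
    exact: subsetUr.
  by apply/orP; right=> /=; apply: contra m0R; apply: (subsetP s2).
have C' Z : Z \subset claimables l M :|: R -> label_dominating l X Z ->
    b (Z :&: claimables l M) \/ b' StallerWins (Z :&: R).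
  move=> sZ hZ; case: (boolP (b Z)) => [/(cap_drop sZ)|nb]; first by left.
  right; apply: (dominating_drop _ (drop_sub sZ) hZ) => //.
  by rewrite nb !orbT.
have C2 Z1 Z2 : Z1 \subset R -> Z2 \subset claimables l M ->
    b' StallerWins (Z1 :|: set0) -> a (Z2 :|: set0) ->
    label_dominating l X (Z1 :|: Z2 :|: set0).
  by move=> s1 s2 w1 w2; rewrite [Z1 :|: _]setUC; apply: C.
split; apply/idP/idP.
- by move=> s2; apply: (second_wins_disjoint dMR second_a s2).
- apply: contraLR => n2; rewrite setUC.
  apply: (not_second_wins_disjoint mW (@mb' _) mb _ _ n2 ns).
    by rewrite disjoint_sym.
  by move=> Z; rewrite setUC => sZ /(C' _ sZ) []; [right|left].
- by move=> s2; rewrite setUC; apply: (first_wins_disjoint _ s2 second_a) => //; rewrite disjoint_sym.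
- by apply: contraLR => n2; apply: (not_first_wins_disjoint mW mb (@mb' _) dMR C' ns n2).
Qed.

(* If only one vertex of a module without contracted vertices survives the
   opponent's move, the module is [K_2] or its complement, and then the game on
   it is won by the same player whoever starts. *)
Let second_a_rest m : ~~ dom_second l M -> dom_first l M ->
  m \in claimables l M -> second_wins a (claimables l M :\ m) set0.
Proof.
move=> ns f mM.
case: (boolP [exists u in M, is_big (l u)]) => [/exists_inP[u uM bu]|].
  by apply: second_wins_true => Z _; apply/exists_inP; exists u; rewrite // /hits bu.
rewrite negb_exists_in => /forall_inP nb.
have CM : claimables l M = M.
  by apply/setP=> z; rewrite inE; case: (boolP (z \in M)) => //= /nb; case: (l z).
move: ns f mM; rewrite /dom_second /dom_first CM => ns f mM.
case: (ltnP 1 #|M :\ m|) => [lt1|].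
  apply: second_wins_sim (second_wins_hit lt1) _ => Z sZ /set0Pn[u].
  rewrite setU0 => uZ; apply/exists_inP; exists u.
    by move: (subsetP sZ u uZ); rewrite inE => /andP[].
  by rewrite /hits uZ orbT.
move: M_gt1; rewrite (cardsD1 m) mM ltnS => c1 c2.
have /cards1P[m' Em'] : #|M :\ m| == 1 by rewrite eqn_leq c2.
have EM : M = [set m; m'] by rewrite -(setD1K mM) Em'.
have nmm : m' != m by have := set11 m'; rewrite -Em' !inE => /andP[].
case/negP: ns; case/first_winsP: f => // -[y yM s].
have [y' Ey nyy] : exists2 y', M :\ y = [set y'] & y' != y.
  move: yM; rewrite EM !inE => /orP[]/eqP->.
    by exists m' => //; rewrite -EM.
  exists m; last by rewrite eq_sym.
  by rewrite setUC setU1K // inE.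
have EMy : M = [set y; y'] by rewrite -(setD1K yM) Ey.
(* Dominator wins by claiming [y] first; Staller then takes [y'], so [y] must dominate it. *)
have ayy : adj G y' y.
  move: s; rewrite Ey => /second_winsP[_ /(_ y')]; rewrite set11 => /(_ isT).
  rewrite setDv => /first_winsP[|[z]]; last by rewrite inE.
  case/second_winsP=> /(_ erefl) + _; rewrite setU0 => /label_dominatingP /(_ y').
  have y'M : y' \in M by rewrite EMy set22.
  rewrite y'M inE (negbTE nyy) => /(_ isT).
  have -> : is_needy (l y') by case: (l y') (nb _ y'M).
  case=> // u uM [au]; rewrite /hits (negbTE (nb _ uM)) inE /= => /eqP eu.
  by rewrite eu in au.
have win x x' : adj G x x' -> M = [set x; x'] -> forall A : {set V}, x \in A -> label_dominating l M A.
  move=> axx EMx A xA; apply/label_dominatingP => v; rewrite EMx !inE => /orP[]/eqP-> _.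
    by rewrite xA.
  by move=> _; exists x; rewrite ?inE ?eqxx // adj_sym axx /hits xA orbT.
apply/second_winsP; split=> [M0|z]; first by rewrite M0 inE in mM.
rewrite [in z \in _]EMy !inE => /orP[]/eqP->.
  rewrite Ey; apply: (first_wins_move (set11 y')); apply: second_wins_true => Z _.
  by apply: (win y' y) => //; rewrite ?inE ?eqxx ?orbT // EMy setUC.
have -> : M :\ y' = [set y] by rewrite EMy setUC setU1K // inE.
apply: (first_wins_move (set11 y)); apply: second_wins_true => Z _.
by apply: (win y y') => //; rewrite ?inE ?eqxx ?orbT // adj_sym.
Qed.

(** [M] simulates [m0]: moving first there secures domination from inside, and if Staller moves
    first there, Dominator still hits [M] by [second_a_rest]. In the converse direction Staller
    simulates [m0]. *)
Lemma contract_FirstWins : ~~ dom_second l M -> dom_first l M ->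
  dom_second (relabel FirstWins) contract = dom_second l X /\
  dom_first (relabel FirstWins) contract = dom_first l X.
Proof.
move=> ns f; have lost := second_a_rest ns f.
move: ns f lost; rewrite /dom_second /dom_first claimablesE claimables'E /= => ns f lost.
have Mn0 : claimables l M != set0.
  apply: contraNneq ns => M0; move: f; rewrite M0 => /first_winsP[//|[y]].
  by rewrite inE.
have C1 Z1 Z2 : Z1 \subset claimables l M -> Z2 \subset R ->
    b Z1 -> b' FirstWins (m0 |: (Z2 :|: set0)) ->
    label_dominating l X (Z1 :|: Z2 :|: set0).
  rewrite !setU0 => s1 s2 hb hb'.
  apply: (dominating_lift _ _ _ hb'); rewrite ?hb //; exact: b_a.
have C0 Z1 Z2 : Z1 \subset claimables l M -> Z2 \subset R ->
    a Z1 -> b' FirstWins (Z2 :|: set0) ->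
    label_dominating l X (Z1 :|: Z2 :|: set0).
  rewrite !setU0 => s1 s2 ha hb'; apply: (dominating_lift _ _ ha hb') => //.
    exact: subsetUr.
  by apply/orP; right=> /=; apply: contra m0R; apply: (subsetP s2).
have D1 Z : Z \subset claimables l M :|: R -> label_dominating l X Z ->
    b' FirstWins (m0 |: Z :&: R).
  move=> sZ hZ; apply: (dominating_drop _ _ hZ); rewrite ?setU11 ?orbT //.
  by apply: subset_trans (drop_sub sZ) _; apply: subsetUr.
have D0 Z : Z \subset claimables l M :|: R -> label_dominating l X Z ->
    b (Z :&: claimables l M) \/ b' FirstWins (Z :&: R).
  move=> sZ hZ; case: (boolP (b Z)) => [/(cap_drop sZ)|nb]; first by left.
  right; apply: (dominating_drop _ (drop_sub sZ) hZ) => //.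
  by rewrite nb !orbT.
split; apply/idP/idP.
- by move=> s2; apply: (second_wins_subst Mn0 f lost m0R dMR _ s2).
- by apply: contraLR; apply: (not_second_wins_subst mW mb (@mb' _) Mn0 m0R dMR ns D1 D0).
- by move=> s2; apply: (first_wins_subst Mn0 f lost m0R dMR _ s2).
- by apply: contraLR; apply: (not_first_wins_subst mW mb (@mb' _) Mn0 m0R dMR ns D1 D0).
Qed.

Theorem contract_outcome :
  dom_second (relabel (outcome l M)) contract = dom_second l X /\
  dom_first (relabel (outcome l M)) contract = dom_first l X.
Proof.
rewrite /outcome; case: ifPn => [|ns]; first exact: contract_DominatorWins.
by case: ifPn => [|nf]; [exact: contract_FirstWins | exact: contract_StallerWins].
Qed.

End OneModule.
End Contraction.

(** * Strategies *)

Lemma complete_play_mem (V : finType) (s : seq V) v : complete_play s -> v \in s.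
Proof.
move=> [us ss]; suff -> : s =i predT by [].
by apply/subset_cardP; [rewrite (card_uniqP us) ss | apply/subsetP].
Qed.

Section Strategies.
Variables (V : finType) (G : graph V) (first p : player).
Implicit Types (s h : seq V).

Definition same_player (q r : player) : bool :=
  match q, r with
  | Dominator, Dominator | Staller, Staller => true
  | _, _ => false
  end.

Lemma same_playerP q r : reflect (q = r) (same_player q r).
Proof. by case: q; case: r; constructor. Qed.

Definition claimed_by s : {set V} :=
  [set v in s | same_player (turn first (index v s)) p].

Lemma turnS i : turn first i.+1 = opponent (turn first i).
Proof. by rewrite /turn /=; case: odd => //=; case: first. Qed.

Lemma claimed_by_rcons h v : v \notin h ->
  claimed_by (rcons h v) =
  if same_player (turn first (size h)) p then v |: claimed_by h else claimed_by h.
Proof.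
move=> vh; apply/setP=> u.
have -> : (u \in if same_player (turn first (size h)) p
                 then v |: claimed_by h else claimed_by h) =
    if same_player (turn first (size h)) p then u \in v |: claimed_by h
    else u \in claimed_by h by case: ifP.
rewrite !inE mem_rcons inE -cats1 index_cat /=.
case: (boolP (u \in h)) => [uh|uh] /=.
  have nuv : u == v = false by apply: contraNF vh => /eqP <-.
  by rewrite nuv /= if_same.
case: (eqVneq u v) => _ /=; last by rewrite if_same.
by rewrite addn0; case: same_player.
Qed.

Variable W : {set V} -> bool.
Hypothesis mW : monotone W.

Definition unclaimed h : {set V} := ~: [set v in h].

(** The fallback keeps the strategy legal at histories that are not winning. *)
Definition greedy_strategy : strategy V := fun h =>
  if [pick y in unclaimed h |
        second_wins W (unclaimed h :\ y) (y |: claimed_by h)] is Some y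
  then Some y else [pick y in unclaimed h].

Lemma greedy_legal : legal greedy_strategy.
Proof.
move=> h uh ltn; rewrite /greedy_strategy.
case: pickP => [y /andP[yU _]|_]; first by exists y; rewrite // !inE in yU *.
case: pickP => [y yU|none]; first by exists y; rewrite // !inE in yU *.
have /card_uniqP := uh; suff -> : #|h| = #|V| by move=> e; rewrite e ltnn in ltn.
by apply: eq_card => y; move: (none y); rewrite !inE => /negbFE.
Qed.

Definition winning h : bool :=
  if same_player (turn first (size h)) p
  then first_wins W (unclaimed h) (claimed_by h)
  else second_wins W (unclaimed h) (claimed_by h).

Lemma unclaimed_rcons h v : unclaimed (rcons h v) = unclaimed h :\ v.
Proof. by apply/setP=> u; rewrite !inE mem_rcons inE negb_or. Qed.

Lemma winning_prefix s h t : uniq s -> consistent first p greedy_strategy s ->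
  s = h ++ t -> winning [::] -> winning h.
Proof.
move=> us con + w0; elim/last_ind: h t => [|h v IH] t // es.
have {}es : s = h ++ v :: t by rewrite es cat_rcons.
have vh : v \notin h.
  by move: us; rewrite es cat_uniq => /and3P[_ /hasPn /(_ v)]; rewrite inE eqxx => /(_ isT).
have vU : v \in unclaimed h by rewrite !inE.
move: {IH}(IH _ es); rewrite /winning size_rcons turnS claimed_by_rcons //.
rewrite unclaimed_rcons; case: same_playerP => [ep|np].
  have -> : same_player (opponent (turn first (size h))) p = false.
    by rewrite ep; case: (p).
  have Un0 : unclaimed h != set0 by apply/set0Pn; exists v.
  (* A play has no passes; where the winning choice is to pass, monotonicity supplies a real
     move. *)
  case/(first_wins_extra mW Un0) => y yU sy.
  have := con _ _ _ es ep; rewrite /greedy_strategy.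
  case: pickP => [z /andP[_ sz] [<-] //|/(_ y)].
  by rewrite yU sy.
have -> : same_player (opponent (turn first (size h))) p = true.
  by move: np; case: turn; case: (p) => // -[].
by case/second_winsP=> _; apply.
Qed.

Lemma greedy_wins : winning [::] ->
  forall s, complete_play s -> consistent first p greedy_strategy s -> W (claimed_by s).
Proof.
move=> w0 s [us ss] con.
have := winning_prefix us con (esym (cats0 s)) w0.
have U0 : unclaimed s = set0.
  by apply/setP=> v; rewrite !inE (complete_play_mem v (conj us ss)).
rewrite /winning U0; case: ifP => _; last by case/second_winsP=> /(_ erefl).
by case/first_winsP=> [/second_winsP[/(_ erefl)]|[y]] //; rewrite inE.
Qed.

End Strategies.

(** * The winner of the alternating game *)

Section Winner.
Variables (V : finType) (G : graph V) (first : player).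

Definition plain : V -> label := fun=> Plain.

Lemma label_dominating_plain A :
  label_dominating G plain setT A = dominating G A.
Proof.
rewrite /label_dominating /dominating; apply: eq_forallb => v.
rewrite inE /=; congr (_ || _); apply: eq_existsb => u.
by rewrite inE /hits /= andbC adj_sym.
Qed.

Lemma dominating_monotone : monotone (dominating G).
Proof.
by move=> A B AB; rewrite -!label_dominating_plain; apply: label_dominating_monotone.
Qed.

Definition winner_of_outcome (o : label) : player :=
  match o with
  | DominatorWins => Dominator
  | StallerWins => Staller
  | _ => first
  end.

Definition goal (p : player) : {set V} -> bool :=
  if p is Dominator then dominating G else dual (dominating G).

Lemma goal_wins p s : complete_play s -> goal p (claimed_by first p s) -> wins G first p s.
Proof.
move=> [us ss].
have E : claimed_by_dominator first s = claimed_by first Dominator s.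
  by apply/setP=> v; rewrite !inE; case: turn.
case: p => /= [dom|]; first by exists (claimed_by first Dominator s); rewrite // E.
have -> : claimed_by first Staller s = ~: claimed_by_dominator first s.
  by apply/setP=> v; rewrite !inE complete_play_mem //=; case: turn.
by rewrite /dual setCK => /negP n [D sD dD]; apply: n; apply: dominating_monotone sD dD.
Qed.

Lemma goal_has_strategy p :
  (if same_player first p then first_wins (goal p) setT set0
   else second_wins (goal p) setT set0) ->
  has_winning_strategy G first p.
Proof.
have mg : monotone (goal p).
  by case: p; [exact: dominating_monotone | exact: dual_monotone dominating_monotone].
move=> w; exists (greedy_strategy first p (goal p)); first exact: greedy_legal.
move=> s cs con; apply: goal_wins => //; apply: greedy_wins con => //.
have U0 : unclaimed [::] = [set: V] by apply/setP=> v; rewrite !inE.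
have A0 : claimed_by first p [::] = set0 :> {set V} by apply/setP=> v; rewrite !inE.
by rewrite /winning U0 A0.
Qed.

Lemma outcome_has_strategy :
  has_winning_strategy G first (winner_of_outcome (outcome G plain setT)).
Proof.
have C : claimables plain [set: V] = setT by apply/setP=> v; rewrite !inE.
have E2 : dom_second G plain setT = second_wins (dominating G) setT set0.
  rewrite /dom_second C.
  by apply/idP/idP => s; apply: second_wins_sim s _ => Z _;
    rewrite setU0 label_dominating_plain.
have E1 : dom_first G plain setT = first_wins (dominating G) setT set0.
  rewrite /dom_first C.
  by apply/idP/idP => s; apply: first_wins_sim s _ => Z _;
    rewrite setU0 label_dominating_plain.
have mD := dominating_monotone.
have F := first_wins_dual [set: V] mD; have S := second_wins_dual [set: V] mD.
rewrite setCT in F S.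
rewrite /outcome E2 E1; case: ifPn => [s2|n2].
  by apply: goal_has_strategy; case: ifP => // _; apply: second_first.
case: ifPn => [f1|n1]; apply: goal_has_strategy.
  by rewrite /=; case: (first) => /=; rewrite ?F.
by case: ifP => _ /=; rewrite ?F ?S.
Qed.

End Winner.

(** * Prime sets and modular-width *)

Section Prime.
Variables (V : finType) (G : graph V).
Implicit Types (M N : {set V}).

(** [G[M]] is prime in the sense of modular decomposition; sets with at most two vertices are
    included. *)
Definition prime_set M : Prop :=
  forall N, N \subset M -> is_module_in G M N -> 1 < #|N| -> N = M.

Lemma fiber_module (I : eqType) (F : V -> I) (r : rel I) M i :
  {in M &, forall x y, F x != F y -> adj G x y = r (F x) (F y)} ->
  is_module_in G M [set x in M | F x == i].
Proof.
move=> h; apply/forall_inP=> w; rewrite !inE negb_and.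
case: (boolP (w \in M)) => //= wM; rewrite andbT => nw.
apply/forall_inP=> u; rewrite inE => /andP[uM /eqP eu].
apply/forall_inP=> v; rewrite inE => /andP[vM /eqP ev].
by rewrite !h ?eu ?ev.
Qed.

(** The fibres of [F] are modules of [G[M]], so a fibre with two vertices is all of [M]. *)
Lemma prime_fiber (I : eqType) (F : V -> I) (r : rel I) M :
  {in M &, forall x y, F x != F y -> adj G x y = r (F x) (F y)} ->
  prime_set M ->
  {in M &, injective F} \/ {in M &, forall x y, F x = F y}.
Proof.
move=> h pM.
case: (boolP [exists x in M, 1 < #|[set y in M | F y == F x]|]).
  case/exists_inP=> x xM lt1; right.
  have E : [set y in M | F y == F x] = M.
    apply: pM => //; last exact: fiber_module h.
    by apply/subsetP=> y; rewrite inE => /andP[].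
  have Fx y : y \in M -> F y = F x by rewrite -E inE => /andP[_ /eqP].
  by move=> y z yM zM; rewrite !Fx.
rewrite negb_exists_in => /forall_inP le1; left => x y xM yM eF.
move: (le1 x xM); rewrite -leqNgt => /card_le1_eqP; apply; by rewrite inE ?xM ?yM ?eF eqxx.
Qed.

End Prime.

Lemma card_inj_in (V I : finType) (F : V -> I) (M : {set V}) :
  {in M &, injective F} -> #|M| <= #|I|.
Proof. by move=> inj; rewrite -(card_in_imset inj) max_card. Qed.

Section SumWidth.
Variables (A B : finType) (GA : graph A) (GB : graph B) (b : bool) (m : nat).
Hypothesis hA : forall (V : finType) (G : graph V) (M : {set V}) (phi : V -> A),
  {in M &, injective phi} ->
  {in M &, forall x y, adj GA (phi x) (phi y) = adj G x y} ->
  prime_set G M -> 2 < #|M| -> #|M| <= m.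
Hypothesis hB : forall (V : finType) (G : graph V) (M : {set V}) (phi : V -> B),
  {in M &, injective phi} ->
  {in M &, forall x y, adj GB (phi x) (phi y) = adj G x y} ->
  prime_set G M -> 2 < #|M| -> #|M| <= m.

(** Three vertices cannot lie on pairwise different sides, so all of [M] is in one operand. *)
Lemma prime_sum (V : finType) (G : graph V) (M : {set V}) (phi : V -> A + B) :
  {in M &, injective phi} ->
  {in M &, forall x y, sum_adj GA GB b (phi x) (phi y) = adj G x y} ->
  prime_set G M -> 2 < #|M| -> #|M| <= m.
Proof.
move=> inj hadj pM gt2.
pose F x := if phi x is inl _ then true else false.
case: (prime_fiber (F := F) (r := fun _ _ => b) _ pM).
- by move=> x y xM yM; rewrite -hadj // /F; case: (phi x); case: (phi y).
- by move/card_inj_in; rewrite card_bool leqNgt gt2.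
have /card_gt0P[x0 x0M] : 0 < #|M| by apply: ltn_trans gt2.
move=> cF; case e0: (phi x0) => [a0|b0].
  (* [a0] is a default value outside [M]; the image of [x0] provides it. *)
  pose psi x := if phi x is inl a then a else a0.
  have psiE x : x \in M -> phi x = inl (psi x).
    by move=> xM; move: (cF x x0 xM x0M); rewrite /F /psi e0; case: (phi x).
  apply: (hA (phi := psi)) pM gt2 => x y xM yM.
    by move=> e; apply: inj => //; rewrite !psiE // e.
  by rewrite -hadj // !psiE.
pose psi x := if phi x is inr a then a else b0.
have psiE x : x \in M -> phi x = inr (psi x).
  by move=> xM; move: (cF x x0 xM x0M); rewrite /F /psi e0; case: (phi x).
apply: (hB (phi := psi)) pM gt2 => x y xM yM.
  by move=> e; apply: inj => //; rewrite !psiE // e.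
by rewrite -hadj // !psiE.
Qed.

End SumWidth.

Lemma prime_subst n (G0 : graph 'I_n) (W : 'I_n -> finType)
    (H : forall i, graph (W i)) (m : 'I_n -> nat) :
  (forall i (V : finType) (G : graph V) (M : {set V}) (phi : V -> W i),
    {in M &, injective phi} ->
    {in M &, forall x y, adj (H i) (phi x) (phi y) = adj G x y} ->
    prime_set G M -> 2 < #|M| -> #|M| <= m i) ->
  forall (V : finType) (G : graph V) (M : {set V}) (phi : V -> {i : 'I_n & W i}),
    {in M &, injective phi} ->
    {in M &, forall x y, subst_adj G0 H (phi x) (phi y) = adj G x y} ->
    prime_set G M -> 2 < #|M| -> #|M| <= maxn n (\max_(i < n) m i).
Proof.
move=> IH V G M phi inj hadj pM gt2; rewrite leq_max.
case: (prime_fiber (F := fun x => tag (phi x)) (r := adj G0) _ pM) => [|injF|cF].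
- by move=> x y xM yM /negbTE ne; rewrite -hadj //= /subst_adj ne.
- by have := card_inj_in injF; rewrite card_ord => ->.
have /card_gt0P[x0 x0M] : 0 < #|M| by apply: ltn_trans gt2.
pose i := tag (phi x0); pose psi x := tagged_as (phi x0) (phi x).
have psiE x : x \in M -> phi x = Tagged W (psi x).
  move=> xM; move: (cF x0 x x0M xM); rewrite /psi.
  by case: (phi x0) (phi x) => [j u] [k v] /= ejk; case: _ / ejk in v *; rewrite tagged_asE.
apply/orP; right; apply: leq_trans (leq_bigmax i).
apply: (IH i V G M psi) pM gt2 => x y xM yM.
  by move=> e; apply: inj => //; rewrite (psiE x xM) (psiE y yM) e.
by rewrite -hadj // (psiE x xM) (psiE y yM) /subst_adj eqxx tagged_asE.
Qed.

(** Stated for an embedding of [G[M]] alone, because the induction passes to an operand of [e],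
    which need not contain the other vertices. *)
Lemma prime_md_width e (V : finType) (G : graph V) (M : {set V})
    (phi : V -> md_vertices e) :
  {in M &, injective phi} ->
  {in M &, forall x y, adj (md_graph e) (phi x) (phi y) = adj G x y} ->
  prime_set G M -> 2 < #|M| -> #|M| <= md_width e.
Proof.
elim: e V G M phi => [|e1 IH1 e2 IH2|e1 IH1 e2 IH2|n G0 sub IH] V G M phi inj hadj pM gt2.
- by have := card_inj_in inj; rewrite card_unit leqNgt (ltn_trans _ gt2).
- by apply: (prime_sum (b := false) _ _ inj hadj pM gt2) => W H N psi i a p g /=;
    rewrite leq_max; apply/orP; [left; apply: IH1 a p g|right; apply: IH2 a p g].
- by apply: (prime_sum (b := true) _ _ inj hadj pM gt2) => W H N psi i a p g /=;
    rewrite leq_max; apply/orP; [left; apply: IH1 a p g|right; apply: IH2 a p g].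
have sum_width := prime_subst (W := fun i => md_vertices (sub i))
  (H := fun i => md_graph (sub i)) (m := fun i => md_width (sub i)) IH.
exact: (sum_width G0 V G M phi inj hadj pM gt2).
Qed.

Lemma prime_modular_width (V : finType) (G : graph V) (M : {set V}) :
  prime_set G M -> #|M| <= maxn 2 (modular_width G).
Proof.
move=> pM; rewrite leq_max; case: leqP => //= gt2.
rewrite /modular_width; case: ex_minnP => m /asboolP[e <- [phi bphi hphi]] _.
apply: (prime_md_width (phi := phi)) pM gt2 => x y _ _; last by rewrite hphi.
exact: (bij_inj bphi).
Qed.

Section Picks.
Variable T : eqType.
Implicit Types (s : seq T).

(** Every way to take one element out of [s], with the rest: moves and pairs are enumerated without
    comparing vertices. *)
Fixpoint picks s : seq (T * seq T) :=
  if s is x :: s' then (x, s') :: [seq (q.1, x :: q.2) | q <- picks s'] else [::].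

Lemma perm_picks s x r : (x, r) \in picks s -> perm_eq (x :: r) s.
Proof.
elim: s x r => //= y s IH x r; rewrite inE => /orP[/eqP[-> ->]|] //.
case/mapP=> -[x' r'] /IH h [-> ->] /=.
by rewrite -(perm_cons y) in h; apply: perm_trans h; rewrite (perm_catCA [:: x'] [:: y]).
Qed.

Lemma mem_picks s x : x \in s -> exists r, (x, r) \in picks s.
Proof.
elim: s => //= y s IH; rewrite inE => /orP[/eqP->|/IH[r h]].
  by exists s; rewrite inE eqxx.
by exists (y :: r); rewrite inE; apply/orP; right; apply/mapP; exists (x, r).
Qed.

Lemma size_picks s : size (picks s) = size s.
Proof. by elim: s => //= x s IH; rewrite size_map IH. Qed.

End Picks.

(** * Programs with a bound on their number of steps *)

Section Bounded.
Variable p : program.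

Definition evals_within env e v T := exists2 t, eval p env e v t & t <= T.

Definition calls f x y T :=
  exists2 body, onth p f = Some body & evals_within [:: x] body y T.

(* The evaluation of a case analysis, once the scrutinee has the value [v]. *)
Definition branch v env e0 e1 w T :=
  match v with
  | Leaf => evals_within env e0 w T
  | Node a b => evals_within (a :: b :: env) e1 w T
  end.

Lemma ew_weaken env e v v' T T' :
  evals_within env e v T -> v = v' -> T <= T' -> evals_within env e v' T'.
Proof. by case=> t ev le <- le'; exists t => //; apply: leq_trans le'. Qed.

Lemma calls_weaken f x y y' T T' :
  calls f x y T -> y = y' -> T <= T' -> calls f x y' T'.
Proof. by case=> b eb ev e le; exists b => //; apply: ew_weaken ev e le. Qed.

Lemma ew_var env i v : onth env i = Some v -> evals_within env (EVar i) v 1.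
Proof. by exists 1 => //; constructor. Qed.

Lemma ew_leaf env : evals_within env ELeaf Leaf 1.
Proof. by exists 1 => //; constructor. Qed.

Lemma ew_node env e1 e2 v1 v2 T1 T2 :
  evals_within env e1 v1 T1 -> evals_within env e2 v2 T2 ->
  evals_within env (ENode e1 e2) (Node v1 v2) (T1 + T2).+1.
Proof.
case=> t1 ev1 le1 [t2 ev2 le2]; exists (t1 + t2).+1; first by constructor.
by rewrite ltnS leq_add.
Qed.

Lemma ew_case env e e0 e1 v w T T' :
  evals_within env e v T -> branch v env e0 e1 w T' ->
  evals_within env (ECase e e0 e1) w (T + T').+1.
Proof.
case=> t ev le; case: v ev => [|a b] ev /= [t' ev' le'];
  exists (t + t').+1; rewrite ?ltnS ?leq_add //.
- exact: eval_case_leaf ev ev'.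
- exact: eval_case_node ev ev'.
Qed.

Lemma ew_let env e1 e2 v1 v2 T1 T2 :
  evals_within env e1 v1 T1 -> evals_within (v1 :: env) e2 v2 T2 ->
  evals_within env (ELet e1 e2) v2 (T1 + T2).+1.
Proof.
case=> t1 ev1 le1 [t2 ev2 le2]; exists (t1 + t2).+1; last by rewrite ltnS leq_add.
exact: eval_let ev1 ev2.
Qed.

Lemma ew_call env f e a v T1 T2 :
  evals_within env e a T1 -> calls f a v T2 ->
  evals_within env (ECall f e) v (T1 + T2).+1.
Proof.
case=> t1 ev1 le1 [body eb [t2 ev2 le2]]; exists (t1 + t2).+1.
  exact: eval_call eb ev1 ev2.
by rewrite ltnS leq_add.
Qed.

Lemma calls_body f x y y' T T' body :
  onth p f = Some body -> evals_within [:: x] body y' T' -> y' = y -> T' <= T ->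
  calls f x y T.
Proof. by move=> eb ev e le; exists body => //; apply: ew_weaken ev e le. Qed.

(** This rule and its analogues hold by definition; they let the symbolic execution choose by the
    head symbol of an encoding, without unfolding it. *)
Lemma branch_leaf env e0 e1 w T :
  evals_within env e0 w T -> branch Leaf env e0 e1 w T.
Proof. by []. Qed.

Lemma branch_node a b env e0 e1 w T :
  evals_within (a :: b :: env) e1 w T -> branch (Node a b) env e0 e1 w T.
Proof. by []. Qed.

Lemma branch_nil (A : Type) (enc : A -> tree) env e0 e1 w T :
  evals_within env e0 w T -> branch (enc_seq enc [::]) env e0 e1 w T.
Proof. by []. Qed.

Lemma branch_cons (A : Type) (enc : A -> tree) x s env e0 e1 w T :
  evals_within (enc x :: enc_seq enc s :: env) e1 w T ->
  branch (enc_seq enc (x :: s)) env e0 e1 w T.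
Proof. by []. Qed.

Lemma branch_0 env e0 e1 w T :
  evals_within env e0 w T -> branch (enc_nat 0) env e0 e1 w T.
Proof. by []. Qed.

Lemma branch_S k env e0 e1 w T :
  evals_within (Leaf :: enc_nat k :: env) e1 w T ->
  branch (enc_nat k.+1) env e0 e1 w T.
Proof. by []. Qed.

Lemma branch_true env e0 e1 w T :
  evals_within (Leaf :: Leaf :: env) e1 w T ->
  branch (enc_bool true) env e0 e1 w T.
Proof. by []. Qed.

Lemma branch_false env e0 e1 w T :
  evals_within env e0 w T -> branch (enc_bool false) env e0 e1 w T.
Proof. by []. Qed.

Lemma branch_bool b env e0 e1 w0 w1 T0 T1 :
  evals_within env e0 w0 T0 -> evals_within (Leaf :: Leaf :: env) e1 w1 T1 ->
  branch (enc_bool b) env e0 e1 (if b then w1 else w0) (maxn T0 T1).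
Proof.
by case: b => ev0 ev1 /=; [apply: ew_weaken ev1 _ _|apply: ew_weaken ev0 _ _];
  rewrite ?leq_maxl ?leq_maxr.
Qed.

End Bounded.

Create HintDb calls_spec.

Definition enc_label (o : label) : tree :=
  Node (enc_bool (is_big o))
       (Node (enc_bool (is_claimable o)) (enc_bool (is_needy o))).

Section Encoding.
Variables (n : nat) (G : graph 'I_n) (l : 'I_n -> label).

Definition enc_row (v : 'I_n) : tree :=
  enc_seq enc_bool [seq adj G v u | u <- enum 'I_n].

Definition enc_vertex (v : 'I_n) : tree :=
  Node (enc_label (l v)) (Node (enc_nat v) (enc_row v)).

Definition enc_pick (q : 'I_n * seq 'I_n) : tree :=
  Node (enc_vertex q.1) (enc_seq enc_vertex q.2).

Variable p : program.

Lemma branch_vertex v env e0 e1 w T :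
  evals_within p (enc_label (l v) :: Node (enc_nat v) (enc_row v) :: env) e1 w T ->
  branch p (enc_vertex v) env e0 e1 w T.
Proof. by []. Qed.

Lemma branch_label o env e0 e1 w T :
  evals_within p (enc_bool (is_big o) ::
    Node (enc_bool (is_claimable o)) (enc_bool (is_needy o)) :: env) e1 w T ->
  branch p (enc_label o) env e0 e1 w T.
Proof. by []. Qed.

Lemma branch_pick q env e0 e1 w T :
  evals_within p (enc_vertex q.1 :: enc_seq enc_vertex q.2 :: env) e1 w T ->
  branch p (enc_pick q) env e0 e1 w T.
Proof. by []. Qed.

End Encoding.

Ltac ew_step :=
  lazymatch goal with
  | |- evals_within _ _ (EVar _) _ _ => eapply ew_var; reflexivity
  | |- evals_within _ _ ELeaf _ _ => eapply ew_leaf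
  | |- evals_within _ _ (ENode _ _) _ _ => eapply ew_node
  | |- evals_within _ _ (ECase _ _ _) _ _ => eapply ew_case
  | |- evals_within _ _ (ELet _ _) _ _ => eapply ew_let
  | |- evals_within _ _ (ECall _ _) _ _ => eapply ew_call
  | |- branch _ Leaf _ _ _ _ _ => eapply branch_leaf
  | |- branch _ (Node _ _) _ _ _ _ _ => eapply branch_node
  | |- branch _ (enc_seq _ [::]) _ _ _ _ _ => eapply branch_nil
  | |- branch _ (enc_seq _ (_ :: _)) _ _ _ _ _ => eapply branch_cons
  | |- branch _ (enc_nat 0) _ _ _ _ _ => eapply branch_0
  | |- branch _ (enc_nat _.+1) _ _ _ _ _ => eapply branch_S
  | |- branch _ (enc_bool true) _ _ _ _ _ => eapply branch_true
  | |- branch _ (enc_bool false) _ _ _ _ _ => eapply branch_false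
  | |- branch _ (enc_bool _) _ _ _ _ _ => eapply branch_bool
  | |- branch _ (enc_vertex _ _ _) _ _ _ _ _ => eapply branch_vertex
  | |- branch _ (enc_label _) _ _ _ _ _ => eapply branch_label
  | |- branch _ (enc_pick _ _ _) _ _ _ _ _ => eapply branch_pick
  | |- calls _ _ _ _ _ => solve [eauto 2 with calls_spec nocore]
  end.

(* Runs the body of a function symbolically; leaves the equation on its value
   and the bound on its number of steps. *)
Ltac run_body := eapply calls_body; [reflexivity | repeat ew_step | | ].

Notation V0 := (EVar 0).
Notation V1 := (EVar 1).
Notation V2 := (EVar 2).
Notation V3 := (EVar 3).
Notation V4 := (EVar 4).
Notation V5 := (EVar 5).
Notation V6 := (EVar 6).
Notation V7 := (EVar 7).
Notation V8 := (EVar 8).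
Notation fst_of e := (ECase e ELeaf V0).
Notation snd_of e := (ECase e ELeaf V1).
Notation true_expr := (ENode ELeaf ELeaf).
(* Binds the components of an argument: [0], [1] for a pair; [2], [0], [1] for a
   triple. *)
Notation in_pair e := (ECase V0 ELeaf e).
Notation in_triple e := (ECase V0 ELeaf (ECase V1 ELeaf e)).

(** * Computability of the parameter bound *)

Definition bound_add := 1.
Definition bound_mul := 2.
Definition bound_pow := 3.

Fixpoint numeral k e := if k is k'.+1 then ENode ELeaf (numeral k' e) else e.

Definition bound_program : program :=
  [:: ECall bound_pow (ENode
          (ECall bound_mul (ENode (numeral 8 ELeaf) (ECall bound_mul (ENode (numeral 3 V0) (numeral 3 V0)))))
          (numeral 7 V0));
      in_pair (ECase V0 V1 (ENode ELeaf (ECall bound_add (ENode V1 V3))));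
      in_pair (ECase V0 ELeaf (ECall bound_add (ENode V3 (ECall bound_mul (ENode V1 V3)))));
      in_pair (ECase V1 true_expr
                 (ECall bound_mul (ENode V2 (ECall bound_pow (ENode V2 V1)))))].

(** The exhaustive search on [s] vertices contributes a factor (8 (s + 1)^2)^(s + 2). Prime sets
    have s <= 2 + k, which gives the base and the exponent 4 + k; three more factors absorb
    numerical constants. *)
Definition bound k := (8 * (3 + k) ^ 2) ^ (7 + k).

Lemma enc_natS k : Node Leaf (enc_nat k) = enc_nat k.+1. Proof. by []. Qed.

Lemma calls_add a b : exists T,
  calls bound_program bound_add (Node (enc_nat a) (enc_nat b)) (enc_nat (a + b)) T.
Proof.
elim: a => [|a [T IH]]; eexists; run_body; rewrite ?enc_natS //.
Qed.

Lemma calls_mul a b : exists T,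
  calls bound_program bound_mul (Node (enc_nat a) (enc_nat b)) (enc_nat (a * b)) T.
Proof.
elim: a => [|a [T IH]]; first by eexists; run_body.
by have [T' IH'] := calls_add b (a * b); eexists; run_body.
Qed.

Lemma calls_pow a b : exists T,
  calls bound_program bound_pow (Node (enc_nat a) (enc_nat b)) (enc_nat (a ^ b)) T.
Proof.
elim: b => [|b [T IH]]; first by eexists; run_body.
have [T' IH'] := calls_mul a (a ^ b); eexists; run_body => //.
by rewrite expnS.
Qed.

Lemma ew_numeral p env c e a T :
  evals_within p env e (enc_nat a) T ->
  exists T', evals_within p env (numeral c e) (enc_nat (c + a)) T'.
Proof.
move=> h; elim: c => [|c [T' IH]]; first by exists T.
by eexists; apply: ew_node IH; apply: ew_leaf.
Qed.

Lemma computable_bound : computable bound.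
Proof.
exists bound_program => k.
suff [T [t ev _]] : exists T, evals_within bound_program [:: enc_nat k] (ECall 0 V0)
    (enc_nat (bound k)) T by exists t.
have [T1 h1] := calls_mul (3 + k) (3 + k).
have [T2 h2] := calls_mul 8 ((3 + k) * (3 + k)).
have [T3 h3] := calls_pow (8 * ((3 + k) * (3 + k))) (7 + k).
have e0 : evals_within bound_program [:: enc_nat k] V0 (enc_nat k) 1 by apply: ew_var.
have num c e a T (h : evals_within bound_program [:: enc_nat k] e (enc_nat a) T) :=
  ew_numeral c h.
have [U1 n1] := num 3 V0 k 1 e0.
have [U2 n2] := num 7 V0 k 1 e0.
have [U3 n3] := num 8 ELeaf 0 1 (ew_leaf _ _).
eexists; eapply ew_call; first by ew_step.
rewrite /bound -mulnn; eapply calls_body; [reflexivity | | reflexivity | exact: leqnn].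
exact: ew_call (ew_node (ew_call (ew_node n3 (ew_call (ew_node n1 n1) h1)) h2) n2) h3.
Qed.

(** * The algorithm *)

(* Vertices are passed as triples (label, (index, row of the adjacency matrix)),
   sets of vertices as lists. No equality test between vertices is needed. *)

Definition f_main := 0.
Definition f_nth := 1.
Definition f_adj := 2.
Definition f_catrev := 3.
Definition f_hasdiff := 4.
Definition f_splits := 5.
Definition f_grow := 6.
Definition f_mapcons := 7.
Definition f_picks := 8.
Definition f_shorter := 9.
Definition f_best_from := 10.
Definition f_best := 11.
Definition f_hasadj := 12.
Definition f_hasbig := 13.
Definition f_alldom := 14.
Definition f_second := 15.
Definition f_allsecond := 16.
Definition f_first := 17.
Definition f_exfirst := 18.
Definition f_claims := 19.
Definition f_outcome := 20.
Definition f_loop := 21.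
Definition f_vertices := 22.

Notation call2 f a b := (ECall f (ENode a b)).
Notation call3 f a b c := (ECall f (ENode a (ENode b c))).
Notation big_of e := (fst_of (fst_of e)).
Notation claimable_of e := (fst_of (snd_of (fst_of e))).
Notation needy_of e := (snd_of (snd_of (fst_of e))).
Notation label_expr b c d := (ENode b (ENode c d)).

(** Pairs and lists are built from the same nodes, so [call2] can also pass a list by head and tail.
    This is how [loop] puts the contracted vertex, with the index and row of the first vertex of the
    module, in front of the vertices outside. *)
Definition mb_program : program := [::
  (* main (player, rows) *)
  in_pair (ELet (ECall f_loop (call2 f_vertices V1 ELeaf))
    (ECase (snd_of (snd_of V0)) true_expr
      (ECase (fst_of (snd_of V2)) ELeaf V5)));
  (* nth (i, s) *)
  in_pair (ECase V0 (fst_of V1) (ECase V3 ELeaf (call2 f_nth V3 V1)));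
  (* adj (u, w) *)
  in_pair (call2 f_nth (fst_of (snd_of V1)) (snd_of (snd_of V0)));
  (* catrev (s, t) *)
  in_pair (ECase V0 V1 (call2 f_catrev V1 (ENode V0 V3)));
  (* hasdiff (w, (C, b)) *)
  in_triple (ECase V0 ELeaf
    (ECase (call2 f_adj V4 V0)
      (ECase V3 (call3 f_hasdiff V4 V1 V3) true_expr)
      (ECase V5 true_expr (call3 f_hasdiff V8 V5 V7))));
  (* splits (w, C) *)
  in_pair (ECase V1 ELeaf (call3 f_hasdiff V2 V1 (call2 f_adj V2 V0)));
  (* grow (R, (acc, C)) *)
  in_triple (ECase V2 (ENode V1 V0)
    (ECase (call2 f_splits V0 V3)
      (call3 f_grow V1 (ENode V0 V2) V3)
      (call3 f_grow (call2 f_catrev V3 V4) ELeaf (ENode V2 V5))));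
  (* mapcons (x, L) *)
  in_pair (ECase V1 ELeaf
    (ENode (ENode (fst_of V0) (ENode V2 (snd_of V0))) (call2 f_mapcons V2 V1)));
  (* picks s *)
  ECase V0 ELeaf (ENode (ENode V0 V1) (call2 f_mapcons V0 (ECall f_picks V1)));
  (* shorter (s, t) *)
  in_pair (ECase V1 ELeaf (ECase V2 true_expr (call2 f_shorter V1 V3)));
  (* best_from (L, (u, best)) *)
  in_triple (ECase V2 V1 (ECase V0 ELeaf
    (ELet (call3 f_grow V1 ELeaf (ENode V0 (ENode V4 ELeaf)))
      (call3 f_best_from V4 V5
        (ECase (call2 f_shorter (fst_of V0) (fst_of V6)) V6 V2)))));
  (* best (L, best) *)
  in_pair (ECase V0 V1 (ECase V0 ELeaf
    (call2 f_best V3 (call3 f_best_from (ECall f_picks V1) V0 V5))));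
  (* hasadj (v, A) *)
  in_pair (ECase V1 ELeaf
    (ECase (call2 f_adj V2 V0) (call2 f_hasadj V2 V1) true_expr));
  (* hasbig (v, B) *)
  in_pair (ECase V1 ELeaf
    (ECase (big_of V0) (call2 f_hasbig V2 V1)
      (ECase (call2 f_adj V4 V2) (call2 f_hasbig V4 V3) true_expr)));
  (* alldom (B', (A, B)) *)
  in_triple (ECase V2 true_expr
    (ECase (needy_of V0) (call3 f_alldom V1 V2 V3)
      (ECase (call2 f_hasadj V2 V4)
        (ECase (call2 f_hasbig V2 V5) ELeaf (call3 f_alldom V5 V6 V7))
        (call3 f_alldom V5 V6 V7))));
  (* second (U, (A, B)) *)
  in_triple (ECase V2 (call3 f_alldom V1 V0 V1)
    (call3 f_allsecond (ECall f_picks V4) V2 V3));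
  (* allsecond (L, (A, B)) *)
  in_triple (ECase V2 true_expr (ECase V0 ELeaf
    (ECase (call3 f_first V1 V4 (ENode V0 V5)) ELeaf
      (call3 f_allsecond V5 V6 V7))));
  (* first (U, (A, B)) *)
  in_triple (ECase (ECall f_second V4)
    (call3 f_exfirst (ECall f_picks V2) V0 V1) true_expr);
  (* exfirst (L, (A, B)) *)
  in_triple (ECase V2 ELeaf (ECase V0 ELeaf
    (ECase (call3 f_second V1 (ENode V0 V4) V5)
      (call3 f_exfirst V3 V4 V5) true_expr)));
  (* claims s *)
  ECase V0 (ENode ELeaf ELeaf)
    (ELet (ECall f_claims V1)
      (ECase (claimable_of V1)
        (ENode (fst_of V0) (ENode V1 (snd_of V0)))
        (ENode (ENode V3 (fst_of V2)) (snd_of V2))));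
  (* outcome s *)
  ELet (ECall f_claims V0)
    (ELet (ENode (fst_of V0) (ENode ELeaf (snd_of V0)))
      (ECase (ECall f_second V0)
        (ECase (ECall f_first V0)
          (label_expr true_expr ELeaf true_expr)
          (label_expr true_expr true_expr true_expr))
        (label_expr true_expr ELeaf ELeaf)));
  (* loop s *)
  ECase V0 (label_expr true_expr ELeaf ELeaf)
    (ECase V1 (fst_of V0)
      (ELet (call2 f_best (ECall f_picks V4) (ENode V4 ELeaf))
        (call2 f_loop
          (ENode (ECall f_outcome (fst_of V0)) (snd_of (fst_of (fst_of V0))))
          (snd_of V0))));
  (* vertices (rows, i) *)
  in_pair (ECase V0 ELeaf
    (ENode (ENode (label_expr ELeaf true_expr true_expr) (ENode V3 V0))
      (call2 f_vertices V1 (ENode ELeaf V3))))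
].

(** * Module closures and a minimum module: correctness and cost *)

Section Correctness.
Variables (n : nat) (G : graph 'I_n).
Implicit Types (l : 'I_n -> label) (s C R : seq 'I_n).

Notation P := mb_program.
Notation ev := (enc_vertex G).
Notation es l := (enc_seq (enc_vertex G l)).

(* [d] bounds the cost of an adjacency test. *)
Variable d : nat.
Hypothesis d_big : 100 * n.+1 <= d.

Let d_ge : 100 <= d. Proof. exact: leq_trans (leq_pmulr _ _) d_big. Qed.

Lemma calls_nth i b : calls P f_nth (Node (enc_nat i) (enc_seq enc_bool b))
  (enc_bool (nth false b i)) (20 * i + 20).
Proof.
elim: i b => [|i IH] [|x b]; run_body => //; lia.
Qed.
Hint Resolve calls_nth : calls_spec.

Lemma calls_adj l u w : calls P f_adj (Node (ev l u) (ev l w))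
  (enc_bool (adj G u w)) d.
Proof.
run_body.
  by rewrite (nth_map w) ?size_enum_ord ?ltn_ord // nth_ord_enum.
have := ltn_ord w; lia.
Qed.
Hint Resolve calls_adj : calls_spec.

Lemma calls_catrev l s t : calls P f_catrev (Node (es l s) (es l t))
  (es l (catrev s t)) (20 * size s + 20).
Proof.
elim: s t => [|x s IH] t; first by run_body.
by have {}IH := IH (x :: t); run_body => //=; lia.
Qed.
Hint Resolve calls_catrev : calls_spec.

Lemma calls_hasdiff l w C b : calls P f_hasdiff
  (Node (ev l w) (Node (es l C) (enc_bool b)))
  (enc_bool (has (fun c => adj G w c != b) C)) (2 * d * (size C).+1).
Proof.
elim: C => [|c C IH]; first by run_body => //; lia.
run_body => /=; last lia.
by case: (adj G w c); case: (b).
Qed.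
Hint Resolve calls_hasdiff : calls_spec.

Definition splits C w :=
  if C is c0 :: C' then has (fun c => adj G w c != adj G w c0) C' else false.

Lemma calls_splits l w C : calls P f_splits (Node (ev l w) (es l C))
  (enc_bool (splits C w)) (4 * d * (size C).+1).
Proof.
case: C => [|c C]; run_body => //=; lia.
Qed.
Hint Resolve calls_splits : calls_spec.

Lemma calls_mapcons l x L : calls P f_mapcons
  (Node (ev l x) (enc_seq (enc_pick G l) L))
  (enc_seq (enc_pick G l) [seq (q.1, x :: q.2) | q <- L]) (30 * (size L).+1).
Proof. elim: L => [|q L IH]; run_body => //=; lia. Qed.
Hint Resolve calls_mapcons : calls_spec.

Lemma calls_picks l s : calls P f_picks (es l s)
  (enc_seq (enc_pick G l) (picks s)) (d * (size s).+1 ^ 2).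
Proof.
elim: s => [|x s IH]; first by run_body => //=; lia.
run_body => //=; rewrite size_picks -!mulnn.
have := leq_mul d_ge (leqnn (size s).+1).
by move: {IH} d_ge; move: (size s) d => S a; lia.
Qed.
Hint Resolve calls_picks : calls_spec.

Lemma calls_shorter l s t : calls P f_shorter (Node (es l s) (es l t))
  (enc_bool (size s < size t)) (30 * (size s).+1).
Proof.
elim: s t => [|x s IH] [|y t]; run_body => //=; lia.
Qed.
Hint Resolve calls_shorter : calls_spec.

(* [grow] moves to [C] the vertices that split it and restarts with all the
   others after each such move, so the expression in parentheses decreases at
   every call. *)
Lemma calls_grow l K N R acc C :
  size R + size acc + size C <= N -> 6 * d * N.+1 <= K ->
  exists C1 R1,
    calls P f_grow (Node (es l R) (Node (es l acc) (es l C)))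
      (Node (es l C1) (es l R1))
      (K * ((size R + size acc) * (size R + size acc).+1 + size R).+1) /\
    and4 (perm_eq (C1 ++ R1) (C ++ R ++ acc))
        {subset C <= C1}
        (~~ has (splits C) acc -> ~~ has (splits C1) R1)
        (forall M : {set 'I_n}, {subset C <= M} ->
          (forall w, w \in R ++ acc -> w \notin M ->
             {in M &, forall u v, adj G w u = adj G w v}) ->
          {subset C1 <= M}).
Proof.
move=> hN hK.
have [m] := ubnP ((size R + size acc) * (size R + size acc).+1 + size R).
elim: m => // m IH in R acc C hN *; move=> ltm.
case: R => [|w R] in hN ltm *.
  exists C, acc; split; first by run_body => //=; lia.
  by split => // [|M sCM _]; rewrite ?cat0s.
have hsp := calls_splits l w C.
case E: (splits C w) hsp => hsp; last first.
  have [||C1 [R1 [hc [h1 h2 h3 h4]]]] := IH R (w :: acc) C.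
  - by move: hN => /=; lia.
  - by move: ltm => /=; lia.
  exists C1, R1; split.
    run_body => //=; nia.
  split => //.
  - apply: perm_trans h1 _; rewrite perm_cat2l.
    by rewrite -cat1s perm_catCA.
  - by move=> nh; apply: h3; rewrite /= E.
  - by move=> M sCM hM; apply: h4 => // z zR; apply: hM; move: zR; rewrite !(inE, mem_cat) => /or3P[]->; rewrite ?orbT.
have [||C1 [R1 [hc [h1 h2 h3 h4]]]] := IH (catrev R acc) [::] (w :: C).
- by move: hN => /=; rewrite catrevE size_cat size_rev; lia.
- by move: ltm => /=; rewrite catrevE size_cat size_rev; nia.
exists C1, R1; split.
  run_body => //=; rewrite catrevE size_cat size_rev /=; nia.
split => //.
- apply: perm_trans h1 _; rewrite cats0 catrevE perm_sym -(cat1s w R) -catA perm_catCA.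
  by rewrite perm_cons perm_cat2l perm_cat2r perm_sym perm_rev.
- by move=> z zC; apply: h2; rewrite inE zC orbT.
- by move=> _; apply: h3.
(* A vertex that splits [C] lies in every such [M]: outside, it would be adjacent to all or none of
   [C]. *)
move=> M sCM hM; apply: h4.
  move=> z; rewrite inE => /orP[/eqP->|/sCM //].
  apply: contraLR E => wM; case: C sCM {hN hsp hc h1 h2 h3 ltm} => //= c0 C sCM.
  apply/hasP => -[c cC]; rewrite (hM w _ wM c c0) ?eqxx // ?mem_head //.
    by apply: sCM; rewrite inE cC orbT.
  by apply: sCM; rewrite mem_head.
by move=> z; rewrite cats0 catrevE mem_cat mem_rev => zR; apply: hM; rewrite mem_cat inE -orbA; move: zR => /orP[]->; rewrite ?orbT.
Qed.

Definition candidate s C R :=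
  [/\ perm_eq (C ++ R) s, 1 < size C & ~~ has (splits C) R].

Definition pair_bound s (u v : 'I_n) C :=
  forall M : {set 'I_n}, is_module_in G [set x in s] M -> u \in M -> v \in M ->
    size C <= #|M|.

Lemma subset_size C (M : {set 'I_n}) : uniq C -> {subset C <= M} -> size C <= #|M|.
Proof.
by move=> /card_uniqP <- sCM; apply: subset_leq_card; apply/subsetP.
Qed.

Lemma calls_best_from l s u L C0 R0 :
  uniq s -> (forall q, q \in L -> perm_eq [:: u, q.1 & q.2] s) ->
  candidate s C0 R0 ->
  exists C1 R1,
    calls P f_best_from
      (Node (enc_seq (enc_pick G l) L) (Node (ev l u) (Node (es l C0) (es l R0))))
      (Node (es l C1) (es l R1)) (7 * d * (size s).+1 ^ 3 * (size L).+1) /\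
    and3 (candidate s C1 R1) (size C1 <= size C0)
      (forall q, q \in L -> pair_bound s u q.1 C1).
Proof.
move=> us; elim: L C0 R0 => [|[v r] L IH] C0 R0 hL cand0.
  exists C0, R0; split; last by split.
  run_body => //=; rewrite muln1 -mulnA.
  have := leq_mul d_ge (leq_pmulr 1 (expn_gt0 (size s).+1 3)); lia.
have hp : perm_eq [:: u, v & r] s by apply: (hL (v, r)); rewrite mem_head.
have sz : size r + 2 = size s by rewrite -(perm_size hp) /= addn2.
have [|C [R [hgrow [h1 h2 h3 h4]]]] :=
    calls_grow (K := 6 * d * (size s).+1) l (R := r) (acc := [::]) (C := [:: v; u]) _ (leqnn _).
  by rewrite /= addn0 sz.
have pCR : perm_eq (C ++ R) s.
  apply: perm_trans h1 _; rewrite cats0; apply: perm_trans hp.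
  by rewrite /= (perm_catCA [:: v] [:: u]).
have uCR : uniq (C ++ R) by rewrite (perm_uniq pCR).
have uC : uniq C by move: uCR; rewrite cat_uniq => /andP[].
have cand : candidate s C R.
  split; rewrite ?h3 //.
  have nvu : v != u by move: us; rewrite -(perm_uniq hp) /= inE eq_sym => /andP[/norP[]].
  have := uniq_leq_size (s1 := [:: v; u]) (s2 := C); rewrite /= inE nvu => /(_ isT); apply.
  by move=> z; apply: h2.
have bnd : pair_bound s u v C.
  move=> M mM uM vM; apply: subset_size => //; apply: h4.
    by move=> z; rewrite !inE => /orP[]/eqP->.
  move=> w; rewrite cats0 => wr wM x y xM yM.
  apply: is_module_inP mM _ wM xM yM.
  by rewrite inE -(perm_mem hp) !inE wr !orbT.
have size_grow : 6 * d * (size s).+1 * ((size r + 0) * (size r + 0).+1 + size r).+1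
                 <= 6 * d * (size s).+1 ^ 3.
  rewrite expnS mulnA leq_mul2l -sz; apply/orP; right.
  by rewrite addn0 -mulnn; move: (size r) => k; lia.
have hsh := calls_shorter l C C0.
have szC : size C <= size s by rewrite -(perm_size pCR) size_cat leq_addr.
have hL' q : q \in L -> perm_eq [:: u, q.1 & q.2] s.
  by move=> qL; apply: hL; rewrite inE qL orbT.
(* Of the seven units [d * (size s).+1 ^ 3], six pay for [grow] and one for the comparison of sizes
   and the remaining steps. *)
have time T : T <= 7 * d * (size s).+1 ^ 3 * (size L).+1 ->
    6 * d * (size s).+1 ^ 3 + 30 * (size s).+1 + T + 100 <=
    7 * d * (size s).+1 ^ 3 * (size L).+2 .
  have e1 := leq_mul d_ge (leq_pmulr (size s).+1 (expn_gt0 (size s).+1 2)).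
  have s2 : 1 < size s by rewrite -sz addn2.
  move: e1 s2; rewrite -expnS; move=> {hsh IH}; move: ((size s).+1 ^ 3) (size s) (size L) d => x a b c.
  lia.
move: (calls_weaken hgrow erefl size_grow) => {}hgrow.
case: ltnP hsh => [lt|le] hsh.
  have [C1 [R1 [hc [i1 i2 i3]]]] := IH C R hL' cand.
  exists C1, R1; split.
    run_body => //=; move: (time _ (leqnn _)) szC.
    by move: (6 * d * _) (7 * d * _ * (size L).+1) (7 * d * _ * (size L).+2); lia.
  split=> //; first exact: leq_trans i2 (ltnW lt).
  move=> q; rewrite inE => /orP[/eqP->|]; last exact: i3.
  by move=> M mM uM vM; apply: leq_trans i2 (bnd M mM uM vM).
have [C1 [R1 [hc [i1 i2 i3]]]] := IH C0 R0 hL' cand0.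
exists C1, R1; split.
  run_body => //=; move: (time _ (leqnn _)) szC.
  by move: (6 * d * _) (7 * d * _ * (size L).+1) (7 * d * _ * (size L).+2); lia.
split=> //; move=> q; rewrite inE => /orP[/eqP->|]; last exact: i3.
by move=> M mM uM vM; apply: leq_trans (leq_trans i2 le) (bnd M mM uM vM).
Qed.

Lemma calls_best_pair l s L C0 R0 :
  uniq s -> (forall q, q \in L -> perm_eq (q.1 :: q.2) s) ->
  candidate s C0 R0 ->
  exists C1 R1,
    calls P f_best
      (Node (enc_seq (enc_pick G l) L) (Node (es l C0) (es l R0)))
      (Node (es l C1) (es l R1)) (9 * d * (size s).+1 ^ 4 * (size L).+1) /\
    and3 (candidate s C1 R1) (size C1 <= size C0)
      (forall q v, q \in L -> v \in q.2 -> pair_bound s q.1 v C1).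
Proof.
move=> us; elim: L C0 R0 => [|[u r] L IH] C0 R0 hL cand0.
  exists C0, R0; split; last by split.
  run_body => //=; rewrite muln1 -mulnA.
  have := leq_mul d_ge (leq_pmulr 1 (expn_gt0 (size s).+1 4)); lia.
have hp : perm_eq (u :: r) s by apply: (hL (u, r)); rewrite mem_head.
have sz : (size r).+1 = size s by rewrite -(perm_size hp).
have hv q : q \in picks r -> perm_eq [:: u, q.1 & q.2] s.
  case: q => v r' /perm_picks h; apply: perm_trans hp; by rewrite perm_cons.
have [C [R [hb [h1 h2 h3]]]] := calls_best_from l us hv cand0.
have hL' q : q \in L -> perm_eq (q.1 :: q.2) s.
  by move=> qL; apply: hL; rewrite inE qL orbT.
have [C1 [R1 [hc [i1 i2 i3]]]] := IH C R hL' h1.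
exists C1, R1; split.
  have hpk := calls_picks l r.
  run_body => //=; rewrite size_picks sz {hpk hc hb IH}.
  (* Of the nine units [d * (size s).+1 ^ 4], seven pay for [best_from], one for [picks] and one for
     the remaining steps. *)
  have e1 : d * size s ^ 2 <= d * (size s).+1 ^ 4.
    rewrite leq_mul2l; apply/orP; right; apply: (@leq_trans ((size s).+1 ^ 2)).
      by rewrite leq_exp2r.
    by rewrite leq_pexp2l.
  have e2 : 7 * d * (size s).+1 ^ 3 * size s <= 7 * (d * (size s).+1 ^ 4).
    by rewrite (expnSr _ 3) -!mulnA !leq_mul2l leqnSn !orbT.
  have e3 : 100 <= d * (size s).+1 ^ 4 by rewrite (leq_trans d_ge) // leq_pmulr ?expn_gt0.
  move: e1 e2 e3.
  by move: ((size s).+1 ^ 4) (7 * d * _ * size s) (d * size s ^ 2) (size L); lia.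
split=> //; first exact: leq_trans i2 h2.
move=> q v; rewrite inE => /orP[/eqP->|]; last exact: i3.
move=> vr M mM uM vM; apply: leq_trans i2 _.
have [r' qr'] := mem_picks vr; exact: h3 qr' _ mM uM vM.
Qed.

End Correctness.

(** * Exhaustive search on a module: correctness and cost *)

Section BruteForce.
Variables (n : nat) (G : graph 'I_n).
Implicit Types (U A B s : seq 'I_n).
Variable d : nat.
Hypothesis d_big : 100 * n.+1 <= d.

Let d_ge : 100 <= d. Proof. exact: leq_trans (leq_pmulr _ _) d_big. Qed.

Variable l : 'I_n -> label.

Notation P := mb_program.
Notation ev := (enc_vertex G l).
Notation es := (enc_seq (enc_vertex G l)).

Hint Resolve calls_adj calls_picks : calls_spec.

Lemma calls_hasadj v A : calls P f_hasadj (Node (ev v) (es A))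
  (enc_bool (has (adj G v) A)) (2 * d * (size A).+1).
Proof.
elim: A => [|a A IH]; first by run_body => //=; lia.
run_body => /=; last lia.
by case: (adj G v a).
Qed.
Hint Resolve calls_hasadj : calls_spec.

Lemma calls_hasbig v B : calls P f_hasbig (Node (ev v) (es B))
  (enc_bool (has (fun u => is_big (l u) && adj G v u) B)) (2 * d * (size B).+1).
Proof.
elim: B => [|u B IH]; first by run_body => //=; lia.
run_body => /=; last lia.
by case: is_big => //=; case: (adj G v u).
Qed.
Hint Resolve calls_hasbig : calls_spec.

Lemma calls_alldom m B' A B : size A + size B < m ->
  calls P f_alldom (Node (es B') (Node (es A) (es B)))
  (enc_bool (all (fun v => [|| ~~ is_needy (l v), has (adj G v) A |
                              has (fun u => is_big (l u) && adj G v u) B]) B'))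
  (5 * d * m * (size B').+1).
Proof.
move=> lt_m; have dm : 100 <= d * m by rewrite (leq_trans d_ge) // leq_pmulr //; lia.
elim: B' => [|v B' IH]; first by run_body => //=; lia.
run_body => /=.
  by case: is_needy => //=; case: has => //=; case: has.
have sAB : d * ((size A).+1 + (size B).+1) <= d * m.+1 by apply: leq_mul => //; lia.
have ddm : d <= d * m by apply: leq_pmulr; lia.
move: sAB ddm dm {IH lt_m}.
by move: (size A) (size B) (size B') d => x y z c; lia.
Qed.
Hint Resolve calls_alldom : calls_spec.

Section Position.
Variable X0 : seq 'I_n.
Hypothesis uX0 : uniq X0.

Let m := size X0.
Let X := [set x in X0].
Let W := label_dominating G l X.
(** [U] is unclaimed and [A] is Dominator's; [B] collects Staller's claims together with the
    vertices that cannot be claimed. *)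
Let pos U A B := perm_eq (U ++ A ++ B) X0.
Let set_of s := [set x in s].

Definition position_cost := 7 * d * m.+1 ^ 2.
(** On [k + 1] vertices each move of Staller leads to [first] on [k] vertices, which calls [second]
    on the same [k] (the pass) and on [k - 1] (each reply), at most 5 (m + 1) times the cost for
    [k]. The 8 leaves room for the overhead. *)
Definition second_cost k := position_cost * (8 * m.+1 ^ 2) ^ k.

Lemma pos_move U A B x r : (x, r) \in picks U -> pos U A B ->
  pos r (x :: A) B /\ pos r A (x :: B).
Proof.
move=> /perm_picks h hp.
have h' : perm_eq (x :: r ++ A ++ B) X0.
  by apply: perm_trans hp; rewrite -cat_cons perm_cat2r.
split; apply: perm_trans h'.
  by rewrite (perm_catCA r [:: x]).
by rewrite -(cat1s x B) catA (perm_catCA (r ++ A) [:: x]) /= catA.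
Qed.

Lemma pos_uniq U A B : pos U A B -> uniq U.
Proof. by move=> /perm_uniq; rewrite uX0 cat_uniq => /andP[]. Qed.

Lemma pick_setD1 U x r : uniq U -> (x, r) \in picks U ->
  x \in set_of U /\ set_of U :\ x = set_of r.
Proof.
move=> uU /perm_picks h; have := perm_uniq h; rewrite uU /= => /andP[xr ur].
split; first by rewrite inE -(perm_mem h) mem_head.
apply/setP=> y; rewrite !inE -(perm_mem h) inE.
by case: eqP => [->|] //=; rewrite (negbTE xr).
Qed.

Lemma second_wins_picks U (A : {set 'I_n}) : U <> [::] -> uniq U ->
  second_wins W (set_of U) A = all (fun q => first_wins W (set_of q.2) A) (picks U).
Proof.
move=> U0 uU; apply/second_winsP/allP => [[_ h] [x r] hq|h].
  by have [xU <-] := pick_setD1 uU hq; apply: h.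
split=> [e|x]; first by case: U U0 e {uU h} => // x U _ /setP/(_ x); rewrite !inE eqxx.
rewrite inE => /mem_picks[r hq]; have [_ ->] := pick_setD1 uU hq; exact: h hq.
Qed.

Lemma first_wins_picks U (A : {set 'I_n}) : uniq U ->
  first_wins W (set_of U) A = second_wins W (set_of U) A ||
    has (fun q => second_wins W (set_of q.2) (q.1 |: A)) (picks U).
Proof.
move=> uU; rewrite /first_wins; congr (_ || _).
apply/exists_inP/hasP => [[y]|[[y r] hq h]].
  rewrite inE => /mem_picks[r hq] h; exists (y, r) => //=.
  by have [_ <-] := pick_setD1 uU hq.
by have [yU e] := pick_setD1 uU hq; exists y; rewrite // e.
Qed.

Lemma set_of_cons y A : set_of (y :: A) = y |: set_of A.
Proof. by apply/setP=> z; rewrite !inE. Qed.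

(** Testing [B] suffices, as the vertices of [A] are claimed; and all of [A] hits, so bigness
    matters in [B] only. *)
Lemma dominating_pos A B : pos [::] A B ->
  all (fun v => [|| ~~ is_needy (l v), has (adj G v) A |
                   has (fun u => is_big (l u) && adj G v u) B]) B =
  second_wins W (set_of [::]) (set_of A).
Proof.
rewrite /pos /= => hp.
have -> : set_of [::] = set0 by apply/setP=> z; rewrite !inE.
have memX z : z \in X = (z \in A) || (z \in B).
  by rewrite inE -(perm_mem hp) mem_cat.
transitivity (W (set_of A)); last first.
  apply/idP/second_winsP => [w|[w _]]; last exact: w.
  by split=> // x; rewrite inE.
apply/allP/label_dominatingP => h v.
  rewrite memX inE => vX nv vA; rewrite (negbTE vA) /= in vX.
  have := h v vX; rewrite nv /= => /orP[/hasP[u uA avu]|/hasP[u uB /andP[bu avu]]].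
    by exists u; rewrite ?memX ?uA // /hits inE uA orbT.
  by exists u; rewrite ?memX ?uB ?orbT // /hits bu.
move=> vB; case: (boolP (is_needy (l v))) => //= nv.
have vA : v \notin set_of A.
  rewrite inE; apply: contraL vB => vA; move: uX0.
  by rewrite -(perm_uniq hp) cat_uniq => /and3P[_ /hasPn h' _]; apply: contraL vA => /h'.
have [|u uX [avu]] := h v _ nv vA; first by rewrite memX vB orbT.
rewrite /hits inE => hu; apply/orP; case: (boolP (u \in A)) hu => uA.
  by move=> _; left; apply/hasP; exists u.
rewrite orbF => bu; right; apply/hasP; exists u; last by rewrite bu.
by move: uX; rewrite memX (negbTE uA).
Qed.

Definition second_ok k := forall U A B, size U = k -> pos U A B ->
  calls P f_second (Node (es U) (Node (es A) (es B)))
    (enc_bool (second_wins W (set_of U) (set_of A))) (second_cost k).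

Definition first_ok k := forall U A B, size U = k -> pos U A B ->
  calls P f_first (Node (es U) (Node (es A) (es B)))
    (enc_bool (first_wins W (set_of U) (set_of A))) (5 * m.+1 * second_cost k).

Lemma calls_exfirst k A B L : second_ok k ->
  (forall q, q \in L -> size q.2 = k /\ pos q.2 (q.1 :: A) B) ->
  calls P f_exfirst (Node (enc_seq (enc_pick G l) L) (Node (es A) (es B)))
    (enc_bool (has (fun q => second_wins W (set_of q.2) (q.1 |: set_of A)) L))
    ((second_cost k + 30) * size L + 20).
Proof.
move=> ok; elim: L => [|[y r] L IH] hL; first by run_body => //=; lia.
have {}IH := IH (fun q qL => hL q (mem_behead (s := _ :: _) qL)).
have [sr pr] := hL (y, r) (mem_head _ _).
have := ok r (y :: A) B sr pr; rewrite set_of_cons => h.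
run_body => /=; last by move: {IH h} (second_cost k) => S; lia.
by case: second_wins.
Qed.

Lemma calls_allsecond k A B L : first_ok k ->
  (forall q, q \in L -> size q.2 = k /\ pos q.2 A (q.1 :: B)) ->
  calls P f_allsecond (Node (enc_seq (enc_pick G l) L) (Node (es A) (es B)))
    (enc_bool (all (fun q => first_wins W (set_of q.2) (set_of A)) L))
    ((5 * m.+1 * second_cost k + 30) * size L + 20).
Proof.
move=> ok; elim: L => [|[y r] L IH] hL; first by run_body => //=; lia.
have {}IH := IH (fun q qL => hL q (mem_behead (s := _ :: _) qL)).
have [sr pr] := hL (y, r) (mem_head _ _).
have h := ok r A (y :: B) sr pr.
run_body => /=; last by move: {IH h} (5 * m.+1 * second_cost k) => S; lia.
by case: first_wins.
Qed.

Lemma size_pick U q : q \in picks U -> (size q.2).+1 = size U.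
Proof. by case: q => x r /perm_picks /perm_size. Qed.

Lemma second_cost_ge k : position_cost <= second_cost k.
Proof. by rewrite /second_cost leq_pmulr // expn_gt0 muln_gt0 expn_gt0. Qed.

Lemma second_costS k : second_cost k.+1 = 8 * m.+1 ^ 2 * second_cost k.
Proof. by rewrite /second_cost expnS mulnCA. Qed.

Lemma second_cost_mono k : second_cost k <= second_cost k.+1.
Proof. by rewrite second_costS leq_pmull // muln_gt0 expn_gt0. Qed.

Lemma pos_size U A B : pos U A B -> size U + (size A + size B) = m.
Proof. by move/perm_size; rewrite !size_cat. Qed.

Let pc_ge : 700 <= position_cost.
Proof.
rewrite /position_cost -mulnA (@leq_mul2l 7 100) (leq_trans d_ge) // leq_pmulr //.

Qed.

Lemma picks_cost k : k <= m -> 7 * (d * k.+1 ^ 2) <= position_cost.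
Proof.
by move=> km; rewrite /position_cost -mulnA !leq_mul2l leq_exp2r // ltnS km !orbT.
Qed.

Lemma first_okI k : second_ok k -> (0 < k -> second_ok k.-1) -> first_ok k.
Proof.
move=> ok ok' U A B sU hp; have uU := pos_uniq hp.
have hs := ok U A B sU hp.
have hx : calls P f_exfirst (Node (enc_seq (enc_pick G l) (picks U)) (Node (es A) (es B)))
    (enc_bool (has (fun q => second_wins W (set_of q.2) (q.1 |: set_of A)) (picks U)))
    ((second_cost k + 30) * k + 20).
  case: k => [|k] in ok ok' sU hs *.
    by move/size0nil: sU ->; rewrite [picks _]/=; run_body => //=; lia.
  have hq q : q \in picks U -> size q.2 = k /\ pos q.2 (q.1 :: A) B.
    case: q => x r qU; split; last by case: (pos_move qU hp).
    by have := size_pick qU; rewrite sU => -[].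
  apply: calls_weaken (calls_exfirst (ok' isT) hq) erefl _.
  by rewrite size_picks sU leq_add2r leq_mul2r leq_add2r second_cost_mono orbT.
have hpk := calls_picks G d_big l U.
run_body => /=; first by rewrite first_wins_picks //; case: second_wins.
have km : k <= m by rewrite -sU -(pos_size hp) leq_addr.
have e1 := picks_cost km; have e2 := second_cost_ge k.
have e3 : second_cost k * k <= second_cost k * m by rewrite leq_mul2l km orbT.
have e4 : 30 * k <= second_cost k * m by apply: leq_mul => //; lia.
rewrite sU; move: (d * k.+1 ^ 2) (second_cost k) position_cost pc_ge e1 e2 e3 e4.
by move: (m) {hpk hx hs}; lia.
Qed.

Lemma second_ok0 : second_ok 0.
Proof.
move=> U A B /size0nil -> hp.
have hm : size A + size B < m.+1 by rewrite -(pos_size hp) ltnS.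
have ha := calls_alldom B hm; rewrite dominating_pos // in ha.
run_body => //=; rewrite /second_cost muln1 /position_cost -mulnn.
have sB : size B < m.+1 by lia.
have e1 : d * m.+1 * (size B).+1 <= d * m.+1 * m.+1 by rewrite leq_mul2l sB orbT.
have e2 : 100 <= d * m.+1 * m.+1.
  by rewrite -mulnA (leq_trans d_ge) // leq_pmulr.
move: e1 e2; rewrite -!(mulnA 5) -!(mulnA 7) -!mulnA.
move: (d * (m.+1 * (size B).+1)) (d * (m.+1 * m.+1)) {ha}; lia.
Qed.

Lemma second_okS k : k < m -> first_ok k -> second_ok k.+1.
Proof.
move=> km ok U A B sU hp; have uU := pos_uniq hp.
have hq q : q \in picks U -> size q.2 = k /\ pos q.2 A (q.1 :: B).
  case: q => x r qU; split; last by case: (pos_move qU hp).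
  by have := size_pick qU; rewrite sU => -[].
have ha := calls_allsecond ok hq.
have hpk := calls_picks G d_big l U.
rewrite size_picks sU in ha; rewrite sU in hpk.
case: U => [|u U] // in sU hp uU hq ha hpk *.
rewrite second_wins_picks //; run_body => //.
have e1 := picks_cost km; have e2 := second_cost_ge k; rewrite second_costS.
have e3 : (5 * m.+1 * second_cost k + 30) * k.+1 <= (5 * m.+1 * second_cost k + 30) * m.
  by rewrite leq_mul2l km orbT.
have e4 : 30 * m <= second_cost k * m by rewrite leq_mul2r; lia.
move: (d * k.+2 ^ 2) (second_cost k) position_cost pc_ge e1 e2 e3 e4 => x S pc.
rewrite -mulnn; move: ((5 * m.+1 * S + 30) * k.+1) => y.
by move: (m) {hpk ha hq km hp}; nia.
Qed.

Lemma second_ok_all k : k <= m -> second_ok k.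
Proof.
suff H j : j <= k -> k <= m -> second_ok j by move=> km; apply: (H k).
elim: k j => [|k IH] j; first by rewrite leqn0 => /eqP-> _; exact: second_ok0.
rewrite leq_eqVlt => /orP[/eqP-> km|jk km]; last by apply: IH => //; exact: ltnW.
have ok i : i <= k -> second_ok i by move=> ik; apply: IH => //; exact: ltnW.
by apply: second_okS => //; apply: first_okI => [|_]; apply: ok => //; exact: leq_pred.
Qed.

End Position.
End BruteForce.

(** * Contracting prime modules until at most one vertex is left *)

Lemma eq_enc_seq (T : Type) (e e' : T -> tree) : e =1 e' -> enc_seq e =1 enc_seq e'.
Proof. by move=> h; elim=> //= x s ->; rewrite h. Qed.

Section Contract.
Variables (n : nat) (G : graph 'I_n).
Implicit Types (l : 'I_n -> label) (s C R : seq 'I_n).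
Variable d : nat.
Hypothesis d_big : 100 * n.+1 <= d.

Let d_ge : 100 <= d. Proof. exact: leq_trans (leq_pmulr _ _) d_big. Qed.

Notation P := mb_program.
Notation ev := (enc_vertex G).
Notation es l := (enc_seq (enc_vertex G l)).
Notation set_of s := [set x in s].

Lemma calls_claims l s :
  calls P f_claims (es l s)
    (Node (es l [seq v <- s | is_claimable (l v)])
          (es l [seq v <- s | ~~ is_claimable (l v)])) (40 * (size s).+1).
Proof.
elim: s => [|v s IH]; first by run_body => //=; lia.
by run_body => //=; [case: is_claimable | lia].
Qed.
Hint Resolve calls_claims : calls_spec.

Lemma second_cost_leq s k : k <= size s -> second_cost d s k <= second_cost d s (size s).
Proof. by move=> ks; rewrite leq_mul2l leq_pexp2l ?orbT ?muln_gt0 ?expn_gt0. Qed.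

(** Beyond the exponent [size s] of the recursion, one factor covers the cost 7 d (s + 1)^2 of a
    final position and one the call of [first]. *)
Lemma calls_outcome l s : uniq s ->
  calls P f_outcome (es l s) (enc_label (outcome G l (set_of s)))
    (d * (8 * (size s).+1 ^ 2) ^ (size s).+2).
Proof.
move=> us; set U := [seq v <- s | is_claimable (l v)].
set B := [seq v <- s | ~~ is_claimable (l v)].
have hp : perm_eq (U ++ [::] ++ B) s by rewrite perm_filterC.
have Us : size U <= size s by rewrite size_filter count_size.
have ok k : k <= size s -> second_ok G d l s k := second_ok_all G d_big l us (k := k).
have h2 := ok _ Us U [::] B erefl hp.
have h1 := first_okI d_big us (ok _ Us) (fun _ => ok _ (leq_trans (leq_pred _) Us)) erefl hp.
have EU : set_of U = claimables l (set_of s).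
  by apply/setP=> v; rewrite !inE mem_filter andbC.
have E0 : set_of ([::] : seq 'I_n) = set0 by apply/setP=> v; rewrite !inE.
move: h1 h2; rewrite /= EU E0 -/(dom_first G l (set_of s)) -/(dom_second G l (set_of s)).
have b1 := second_cost_leq Us.
have b2 : 700 * (size s).+1 <= second_cost d s (size s).
  apply: leq_trans (second_cost_ge d s (size s)); rewrite /position_cost.
  by apply: leq_mul; [rewrite (@leq_mul2l 7 100)|rewrite -mulnn leq_pmulr].
have b3 : second_cost d s (size s).+1 <= d * (8 * (size s).+1 ^ 2) ^ (size s).+2.
  rewrite /second_cost /position_cost [_ ^ (size s).+2]expnS !mulnA leq_mul2r.
  by rewrite (mulnC 7) !leq_mul2r leq_mul2l !orbT.
move: b3; rewrite second_costS => b3 h1 h2.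
have bnd : 40 * (size s).+1 + second_cost d s (size U) +
    5 * (size s).+1 * second_cost d s (size U) + 60 <=
    d * (8 * (size s).+1 ^ 2) ^ (size s).+2.
  apply: leq_trans b3; apply: (@leq_trans ((3 + 5 * (size s).+1) * second_cost d s (size s))).
    have b4 := leq_mul (leqnn (5 * (size s).+1)) b1.
    move: b1 b2 b4 {h1 h2}.
    by move: (second_cost d s (size U)) (second_cost d s (size s)) (size s); lia.
  by rewrite leq_mul2r -mulnn; apply/orP; right; move: (size s); lia.
rewrite /outcome; run_body; last first.
- move: bnd {b1 b2 b3 h1 h2}; move: (second_cost d s (size U)) => S.
  by move: (5 * _ * S) (d * _); lia.
- by case: dom_second => //; case: dom_first.
Qed.
Hint Resolve calls_outcome : calls_spec.

Lemma candidate_module s C R : uniq s -> candidate G s C R ->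
  is_module_in G (set_of s) (set_of C).
Proof.
move=> us [hp _ /hasPn h]; apply/forall_inP=> w; rewrite !inE => /andP[wC ws].
have wR : w \in R by move: ws; rewrite -(perm_mem hp) mem_cat (negbTE wC).
have {h} := h w wR; case: C hp wC => [|c C] hp wC /=.
  by move=> _; apply/forall_inP=> u; rewrite inE.
move/hasPn => h; have e u : u \in c :: C -> adj G w u = adj G w c.
  by rewrite inE => /orP[/eqP-> //|/h /negbNE/eqP].
apply/forall_inP=> u; rewrite inE => uC; apply/forall_inP=> v; rewrite inE => vC.
by rewrite !e.
Qed.

(** A module of a module is a module of the whole graph, so by minimality [C] has no smaller one
    with two vertices. *)
Lemma candidate_prime s C R : uniq s -> candidate G s C R ->
  (forall M : {set 'I_n}, is_module_in G (set_of s) M -> M \subset set_of s ->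
     1 < #|M| -> size C <= #|M|) ->
  prime_set G (set_of C).
Proof.
move=> us cand hmin N sN mN N1; apply/eqP; rewrite eqEcard sN /=.
have [hp _ _] := cand; have mC := candidate_module us cand.
have uC : uniq C by move: us; rewrite -(perm_uniq hp) cat_uniq => /andP[].
have sCs : set_of C \subset set_of s.
  by apply/subsetP=> v; rewrite !inE -(perm_mem hp) mem_cat => ->.
rewrite cardsE (card_uniqP uC); apply: hmin => //; last exact: subset_trans sN sCs.
apply/forall_inP=> w; rewrite inE => /andP[wN ws].
apply/forall_inP=> u uN; apply/forall_inP=> v vN; apply/eqP.
case: (boolP (w \in set_of C)) => wC; first exact: is_module_inP mN wC wN uN vN.
by apply: is_module_inP mC ws wC _ _; apply: (subsetP sN).
Qed.

Lemma calls_best l s : uniq s -> 1 < size s ->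
  exists C R,
    calls P f_best (Node (enc_seq (enc_pick G l) (picks s)) (Node (es l s) Leaf))
      (Node (es l C) (es l R)) (9 * d * (size s).+1 ^ 5) /\
    candidate G s C R /\ prime_set G (set_of C).
Proof.
move=> us s1.
have hq q : q \in picks s -> perm_eq (q.1 :: q.2) s by case: q => x r /perm_picks.
have c0 : candidate G s s [::] by split; rewrite ?cats0.
have [C [R [hc [i1 _ i3]]]] := calls_best_pair d_big l us hq c0.
exists C, R; split.
  by apply: calls_weaken hc erefl _; rewrite size_picks -mulnA -expnSr.
split=> //; apply: candidate_prime us i1 _ => M mM sM /card_gt1P[u [v [uM vM nuv]]].
have us' : u \in s by move: (subsetP sM u uM); rewrite inE.
have [r hr] := mem_picks us'.
apply: (i3 (u, r) v hr _ M mM uM vM).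
have : v \in s by move: (subsetP sM v vM); rewrite inE.
by rewrite -(perm_mem (perm_picks hr)) inE eq_sym (negbTE nuv).
Qed.

(** Weaker than equality of [o] with the outcome: [Plain] and [FirstWins] are not told apart, so the
    loop may return the label of the last vertex unchanged. *)
Definition summarizes l s o :=
  dom_second G l (set_of s) = ~~ is_needy o /\
  dom_first G l (set_of s) = ~~ is_needy o || is_claimable o.

Lemma summarizes_nil l : summarizes l [::] DominatorWins.
Proof.
suff h : dom_second G l (set_of ([::] : seq 'I_n)).
  by split; rewrite ?h //; apply: second_first.
apply/second_winsP; split=> [_|x]; last by rewrite !inE.
by apply/label_dominatingP => v; rewrite inE.
Qed.

Lemma summarizes_seq1 l v : summarizes l [:: v] (l v).
Proof.
have W Z : label_dominating G l (set_of [:: v]) Z = ~~ is_needy (l v) || (v \in Z).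
  apply/label_dominatingP/orP => [h|h x]; last first.
    by rewrite !inE => /eqP-> nv vZ; case: h; rewrite ?nv ?(negbTE vZ).
  case: (boolP (is_needy (l v))) => nv; last by left.
  right; apply: contraT => vZ; case: (h v) => //; first by rewrite !inE.
  by move=> u; rewrite !inE => /eqP->; rewrite adj_irr => -[].
have cl : claimables l (set_of [:: v]) = if is_claimable (l v) then [set v] else set0.
  apply/setP=> x; rewrite !inE; case: eqP => [->|ne]; case: ifP => //= _; rewrite !inE ?eqxx //.
  by apply/esym/eqP.
have s0 Z : second_wins (label_dominating G l (set_of [:: v])) set0 Z =
    ~~ is_needy (l v) || (v \in Z).
  rewrite -W; apply/second_winsP/idP => [[h _]|w]; first exact: h.
  by split=> // x; rewrite inE.
have f0 Z : first_wins (label_dominating G l (set_of [:: v])) set0 Z =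
    ~~ is_needy (l v) || (v \in Z).
  rewrite -s0; apply/first_winsP/idP => [[//|[y]]|]; rewrite ?inE //; by left.
rewrite /summarizes /dom_second /dom_first cl; case: ifP => cv; last first.
  by rewrite s0 f0 inE !orbF.
split.
  apply/second_winsP/idP => [[_ /(_ v)]|nn].
    by rewrite inE setDv f0 inE orbF; apply.
  split=> [/setP/(_ v)|x]; rewrite !inE ?eqxx // => /eqP->.
  by rewrite setDv f0 nn.
rewrite orbT; apply: (first_wins_move (set11 v)).
by rewrite setDv s0 !inE eqxx orbT.
Qed.

Lemma summarizes_contract l s c C R o : uniq s -> candidate G s (c :: C) R ->
  summarizes (relabel l c (outcome G l (set_of (c :: C)))) (c :: R) o ->
  summarizes l s o.
Proof.
move=> us cand; have [hp s1 _] := cand.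
have := candidate_module us cand => mC.
have sCs : set_of (c :: C) \subset set_of s.
  by apply/subsetP=> v; rewrite !in_set -(perm_mem hp) mem_cat => ->.
have uC : uniq (c :: C) by move: us; rewrite -(perm_uniq hp) cat_uniq => /andP[].
have C1 : 1 < #|set_of (c :: C)| by rewrite cardsE (card_uniqP uC).
have cC : c \in set_of (c :: C) by rewrite in_set mem_head.
have [e2 e1] := contract_outcome l sCs mC C1 cC.
have E : contract (set_of s) (set_of (c :: C)) c = set_of (c :: R).
  have uCR : uniq ((c :: C) ++ R) by rewrite (perm_uniq hp).
  apply/setP=> v; rewrite in_setU1 in_setD !in_set -(perm_mem hp) mem_cat !in_cons.
  case: eqP => [->|_] //=; case: (boolP (v \in R)) => [vR|_]; last first.
    by rewrite orbF; case: (v \in C).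
  move: uCR; rewrite cat_uniq => /and3P[_ /hasPn /(_ v vR)].
  by rewrite inE negb_or => /andP[_ ->]; rewrite orbT.
by rewrite /summarizes -E e1 e2.
Qed.

Section Loop.
Variable k : nat.
Hypothesis prime_le : forall M : {set 'I_n}, prime_set G M -> #|M| <= maxn 2 k.

Let g := (8 * (3 + k) ^ 2) ^ (4 + k).

Lemma outcome_cost C : size C <= maxn 2 k ->
  (8 * (size C).+1 ^ 2) ^ (size C).+2 <= g.
Proof.
move=> hC; have h : size C <= 2 + k by apply: leq_trans hC _; lia.
apply: (@leq_trans ((8 * (3 + k) ^ 2) ^ (size C).+2)).
  by rewrite leq_exp2r // leq_mul2l leq_exp2r.
by rewrite leq_pexp2l // muln_gt0 expn_gt0.
Qed.

Lemma calls_loop l s : uniq s ->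
  exists o, calls P f_loop (es l s) (enc_label o) (12 * (d * n.+1 ^ 5 * g) * (size s).+1) /\
    summarizes l s o.
Proof.
have g1 : 0 < g by rewrite expn_gt0 muln_gt0 expn_gt0.
have n1 : 0 < n.+1 ^ 5 by rewrite expn_gt0.
have D : 100 <= d * n.+1 ^ 5 * g.
  by rewrite -mulnA (leq_trans d_ge) // leq_pmulr // muln_gt0 n1.
have [m] := ubnP (size s); elim: m => // m IH in l s *; move=> ltm us.
case: s => [|v [|v' s]] in ltm us *.
- exists DominatorWins; split; last exact: summarizes_nil.
  by run_body => //; move: D; move: (d * _ * g); lia.
- exists (l v); split; last exact: summarizes_seq1.
  by run_body => //; move: D; move: (d * _ * g); rewrite /=; lia.
set t := [:: v, v' & s] in ltm us *.
have [C [R [hb [cand pC]]]] := calls_best l us isT.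
have [hp sC _] := cand; have leC := prime_le pC.
case: C => // c C in hb cand pC hp sC leC *.
have uCR : uniq ((c :: C) ++ R) by rewrite (perm_uniq hp).
have uC : uniq (c :: C) by move: uCR; rewrite cat_uniq => /andP[].
have ucR : uniq (c :: R).
  move: uCR; rewrite cat_uniq => /and3P[_ /hasPn h uR] /=; rewrite uR andbT.
  by apply/negP => /h; rewrite mem_head.
have st : size C + (size R).+1 = size t by rewrite -(perm_size hp) size_cat /= addnS.
have ltR : (size R).+1 < size t by rewrite -st -[X in X < _]add0n ltn_add2r.
have [|o [hl ho]] := IH (relabel l c (outcome G l (set_of (c :: C)))) (c :: R) _ ucR.
  exact: leq_trans ltR ltm.
exists o; split; last exact: summarizes_contract ho.
(* The program changes the label of [c] only; on [R], which does not contain [c], both labellings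
   have the same encoding. *)
have E : es (relabel l c (outcome G l (set_of (c :: C)))) (c :: R) =
    Node (Node (enc_label (outcome G l (set_of (c :: C)))) (Node (enc_nat c) (enc_row G c)))
         (es l R).
  rewrite /= /enc_vertex /relabel eqxx; congr Node.
  move: ucR => /= /andP[cR _]; elim: (R) cR => //= x r IHr.
  rewrite inE negb_or eq_sym => /andP[/negbTE-> /IHr ->] //.
rewrite E in hl.
have hout := calls_outcome l uC.
have hpk := calls_picks G d_big l t.
rewrite cardsE (card_uniqP uC) in leC.
have tn : size t <= n by have := max_card [in t]; rewrite card_ord (card_uniqP us).
(* Of the twelve units per round, nine pay for [best], one each for [picks] and [outcome], and one
   for the remaining steps. *)
have b1 : 9 * d * (size t).+1 ^ 5 <= 9 * (d * n.+1 ^ 5 * g).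
  rewrite -(mulnA 9) -(mulnA d) !leq_mul2l.
  by rewrite (leq_trans _ (leq_pmulr (n.+1 ^ 5) g1)) ?orbT // leq_exp2r.
have b2 : d * (size t).+1 ^ 2 <= d * n.+1 ^ 5 * g.
  rewrite -(mulnA d) leq_mul2l; apply/orP; right.
  apply: leq_trans (leq_pmulr (n.+1 ^ 5) g1); apply: (@leq_trans (n.+1 ^ 2)); first by rewrite leq_exp2r.
  by rewrite leq_pexp2l.
have b3 : d * (8 * (size (c :: C)).+1 ^ 2) ^ (size (c :: C)).+2 <= d * n.+1 ^ 5 * g.
  rewrite (mulnAC d); apply: (@leq_trans (d * g)); last exact: leq_pmulr.
  by rewrite leq_mul2l outcome_cost ?orbT.
have hout' := calls_weaken hout erefl b3.
have hpk' := calls_weaken hpk erefl b2.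
have hb' := calls_weaken hb erefl b1.
have ltR' : 12 * (d * n.+1 ^ 5 * g) * (size (c :: R)).+1 <= 12 * (d * n.+1 ^ 5 * g) * size t.
  by rewrite leq_mul2l ltR orbT.
have hl' := calls_weaken hl erefl ltR'.
clear hl hb hpk hout; rewrite {1}/t.
run_body => //.
by move: D; move: (d * _ * g) (size t) {E hp st ltR ltm tn b1 b2 b3 hout' hpk' hb' ltR' hl'}; lia.
Qed.

Lemma calls_vertices s i : map val s = iota i (size s) ->
  calls P f_vertices (Node (enc_seq (enc_row G) s) (enc_nat i))
    (es (@plain _) s) (40 * (size s).+1).
Proof.
elim: s i => [|v s IH] i; first by move=> _; run_body => //=; lia.
by move=> /= [<- /IH h]; run_body => //=; lia.
Qed.

Lemma calls_main first : calls P f_main (Node (enc_player first) (enc_graph G))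
  (enc_player (winner_of_outcome first (outcome G (@plain _) setT)))
  (13 * (d * n.+1 ^ 6 * g)).
Proof.
have Erows : enc_graph G = enc_seq (enc_row G) (enum 'I_n).
  by apply: eq_enc_seq => v; rewrite /enc_row /enc_seq foldr_map.
have hv : calls P f_vertices (Node (enc_graph G) Leaf) (es (@plain _) (enum 'I_n)) (40 * n.+1).
  have hs := @size_enum_ord n; rewrite Erows.
  have := @calls_vertices (enum 'I_n) 0; rewrite hs val_enum_ord; exact.
have [o [hl [e2 e1]]] := calls_loop (@plain _) (enum_uniq 'I_n).
rewrite size_enum_ord in hl.
have ET : set_of (enum 'I_n) = setT by apply/setP=> v; rewrite !inE mem_enum.
rewrite ET in e1 e2; rewrite /outcome e1 e2.
(* [o] may be [Plain] where the outcome is [FirstWins]; the first player wins in both cases. *)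
run_body; first by case: (o) => //; case: (first).
rewrite -mulnA.
have -> : d * n.+1 ^ 5 * g * n.+1 = d * n.+1 ^ 6 * g.
  by rewrite (expnSr _ 5) (mulnA d) (mulnAC _ g).
have : d <= d * n.+1 ^ 6 * g.
  by rewrite -(mulnA d) leq_pmulr // muln_gt0 /g !(expn_gt0, muln_gt0).
by move: d_big; move: (d * _ * g) {hv hl}; lia.
Qed.

End Loop.
End Contract.

Theorem theorem4p3 :
  fpt enc_mb_instance enc_player mb_order mb_modular_width mb_dom_game.
Proof.
(* Six factors [n.+1] come from [calls_main], the seventh from the adjacency cost [100 * n.+1]. *)
exists mb_program, bound, 7; split; first exact: computable_bound.
case=> n G first; set k := modular_width G.
have pk (M : {set 'I_n}) : prime_set G M -> #|M| <= maxn 2 k by exact: prime_modular_width.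
have [body eb [t ev le_t]] := calls_main (leqnn (100 * n.+1)) pk first.
exists (winner_of_outcome first (outcome G (@plain _) setT)), (1 + t).+1; split.
- exact: outcome_has_strategy.
- by apply: eval_call eb _ ev; constructor.
rewrite /mb_modular_width /= -/k; set x := maxn 1 n.
have lt_t : t.+2 <= 14 * (100 * n.+1 * n.+1 ^ 6 * (8 * (3 + k) ^ 2) ^ (4 + k)).
  have : 2 <= 100 * n.+1 * n.+1 ^ 6 * (8 * (3 + k) ^ 2) ^ (4 + k).
    rewrite -!(mulnA 100); apply: leq_trans (leq_pmulr 100 _) => //.
    by rewrite !(expn_gt0, muln_gt0).
  by move: le_t; move: (100 * _ * _ * _) => y; lia.
apply: leq_trans lt_t _.
have nx : n.+1 <= 2 * x by rewrite /x; lia.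
have B72 : 72 <= 8 * (3 + k) ^ 2 by rewrite (@leq_mul2l 8 (3 ^ 2)) leq_exp2r.
have -> : bound k = (8 * (3 + k) ^ 2) ^ 3 * (8 * (3 + k) ^ 2) ^ (4 + k).
  by rewrite -expnD.
move: (8 * _) B72 => b B72; move: (b ^ _) => g.
have hx : n.+1 ^ 7 <= 2 ^ 7 * x ^ 7 by rewrite -expnMn leq_exp2r.
apply: (@leq_trans (14 * (100 * (2 ^ 7 * x ^ 7 * g)))).
  by rewrite -(mulnA 100) -expnS -mulnA !leq_mul2l leq_mul2r hx !orbT.
(* 14 * 100 * 2 ^ 7 = 56 * 50 * 64, with all three factors below 72, so the three spare factors [b]
   of [bound] absorb them. *)
apply: (@leq_trans (56 * (50 * (64 * (x ^ 7 * g))))).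
  by rewrite -(mulnA (2 ^ 7)); move: (x ^ 7 * g) => y; lia.
move: (x ^ 7) => y; rewrite !expnS expn0 muln1 (mulnC y) -!mulnA.
by rewrite !leq_mul // (leq_trans _ B72).
Qed.
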